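(* Let $\Gamma$ be a property (T) group. Let $S$ be a symmetric finite generating set for $\Gamma$, let $\kappa>0$ be a Kazhdan constant for $(\Gamma,S)$, and let $\lambda=\kappa^2/(2|S|)$. Then there exist a finite set $F$ with $S\subset F\subset\Gamma$ and a constant $C$ such that for every $\epsilon>0$, every Hilbert space $\mathcal{H}$ and every operator norm $(F,\epsilon)$-approximate representation $\pi:\Gamma\to U(\mathcal{H})$ we have $$\sigma(\tilde\pi(\Delta_S))\subset[0,C\epsilon]\cup[\lambda-C\epsilon,2],$$ where $\tilde\pi(\Delta_S)=1-\frac1{|S|}\sum_{s\in S}\pi(s)\in B(\mathcal{H})$ is the Laplacian associated with $\pi$.
   Context: $\kappa>0$ is a Kazhdan constant for $(\Gamma,S)$ if for every unitary representation $(\rho,\mathcal{K})$ of $\Gamma$ without nonzero invariant vectors and every $\xi\in\mathcal{K}$, $\max_{s\in S}\|\rho(s)\xi-\xi\|\ge\kappa\|\xi\|$. For a finite $F\subset\Gamma$ and $\epsilon>0$, a map $\pi:\Gamma\to U(\mathcal{H})$ is an operator norm $(F,\epsilon)$-approximate representation if $\|\pi(gh)-\pi(g)\pi(h)\|_{\mathrm{op}}\le\epsilon$ for all $g,h\in F$ and $\pi(g^{-1})=\pi(g)^{-1}$ for all $g\in F$. $\sigma(\cdot)$ denotes the spectrum. *)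

(* Defs.v *)
From HB Require Import structures.
From mathcomp Require Import all_boot all_order all_algebra.
From mathcomp Require Import finmap complex.
From mathcomp Require Import all_classical all_reals all_analysis.

Set Implicit Arguments.
Unset Strict Implicit.
Unset Printing Implicit Defensive.

Import Order.TTheory GRing.Theory Num.Theory.
Import numFieldNormedType.Exports.

Local Open Scope classical_set_scope.
Local Open Scope complex_scope.
Local Open Scope ring_scope.

(* The inner product is linear in its first argument. *)
HB.mixin Record CompleteNormedModule_isHilbert (R : realType) H
    of CompleteNormedModule R[i] H := {
  inner : {dot H for Num.conj};
  sqr_norm_inner : forall x : H, `|x| ^+ 2 = inner x x
}.

#[short(type="hilbertType")]
HB.structure Definition Hilbert (R : realType) :=
  {H of CompleteNormedModule R[i] H & CompleteNormedModule_isHilbert R H}.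

Section Operators.
Context {R : realType} {H : hilbertType R}.
Implicit Types (T : H -> H) (x y : H).

(* The norm of a normed module over [R[i]] takes its (real) values in [R[i]]. *)
Definition rnorm x : R := complex.Re `|x|.

Definition opnorm T : R := sup [set rnorm (T x) | x in [set x | rnorm x <= 1]].

(* The inverse of [z - T] is sought in B(H), whose elements are the continuous
   linear maps. *)
Definition spectrum T : set R[i] :=
  [set z | ~ exists U : {linear H -> H},
    [/\ continuous U,
        forall x, U (z *: x - T x) = x
      & forall x, z *: U x - T (U x) = x]].

Definition is_adjoint T T' : Prop :=
  forall x y, inner (T x) y = inner x (T' y).

(* [U^* U = U U^* = 1]; such a map is automatically bounded. *)
Definition is_unitary T : Prop :=
  linear T /\ exists T', [/\ is_adjoint T T', cancel T T' & cancel T' T].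

End Operators.

Record unitary (R : realType) (H : hilbertType R) := Unitary {
  unitary_fun :> H -> H;
  unitaryP : is_unitary unitary_fun
}.

Section UnitaryGroup.
Context {R : realType} {H : hilbertType R}.
Implicit Types U V W : unitary H.

Lemma unitary_eq U V : U =1 V -> U = V.
Proof.
case: U V => [f hf] [g hg] /= /funext fg.
by subst g; congr Unitary; exact: Prop_irrelevance.
Qed.

HB.instance Definition _ U :=
  @GRing.isLinear.Build R[i] H H *:%R (unitary_fun U) (unitaryP U).1.

HB.instance Definition _ := gen_eqMixin (unitary H).
HB.instance Definition _ := gen_choiceMixin (unitary H).

Lemma is_unitary_id : is_unitary (@id H).
Proof. by split=> //; exists id. Qed.

Lemma is_unitary_comp U V : is_unitary (U \o V).
Proof.
split; first by move=> a x y /=; rewrite !linearP.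
have [_ [U' [aU UK U'K]]] := unitaryP U.
have [_ [V' [aV VK V'K]]] := unitaryP V.
exists (V' \o U'); split; [|exact: can_comp|exact: can_comp].
by move=> x y /=; rewrite aU aV.
Qed.

Definition unitary_adj U : H -> H := sval (cid (unitaryP U).2).

Lemma unitary_adjP U :
  [/\ is_adjoint U (unitary_adj U), cancel U (unitary_adj U)
    & cancel (unitary_adj U) U].
Proof. exact: svalP (cid (unitaryP U).2). Qed.

Lemma is_unitary_adj U : is_unitary (unitary_adj U).
Proof.
have [aU UK U'K] := unitary_adjP U.
split; first by move=> a x y; apply: (can_inj UK); rewrite (unitaryP U).1 !U'K.
by exists U; split=> // x y; rewrite -{2}[x]U'K aU UK.
Qed.

Definition unitary_one : unitary H := Unitary is_unitary_id.
Definition unitary_mul U V : unitary H := Unitary (is_unitary_comp U V).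
Definition unitary_inv U : unitary H := Unitary (is_unitary_adj U).

Lemma unitary_mulA : associative unitary_mul.
Proof. by move=> U V W; exact: unitary_eq. Qed.

Lemma unitary_mul1 : left_id unitary_one unitary_mul.
Proof. by move=> U; exact: unitary_eq. Qed.

Lemma unitary_1mul : right_id unitary_one unitary_mul.
Proof. by move=> U; exact: unitary_eq. Qed.

Lemma unitary_mulV : left_inverse unitary_one unitary_inv unitary_mul.
Proof. by move=> U; apply: unitary_eq; have [] := unitary_adjP U. Qed.

Lemma unitary_Vmul : right_inverse unitary_one unitary_inv unitary_mul.
Proof. by move=> U; apply: unitary_eq; have [] := unitary_adjP U. Qed.

HB.instance Definition _ := isGroup.Build (unitary H)
  unitary_mulA unitary_mul1 unitary_1mul unitary_mulV unitary_Vmul.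

End UnitaryGroup.

Section PropertyT.
Context {G : groupType}.
Implicit Types S F : {fset G}.

Definition symmetric_fset S : Prop := forall s, s \in S -> (s^-1)%g \in S.

(* The only subgroup containing S is G. *)
Definition generating S : Prop :=
  forall K : {pred G}, group_closed K -> {subset S <= K} -> forall g, g \in K.

Context {R : realType}.

Definition no_invariant_vectors (K : hilbertType R)
    (rho : {multiplicative G -> unitary K}) : Prop :=
  forall xi : K, (forall g, rho g xi = xi) -> xi = 0.

(* Displacements are nonnegative, so 0 is a neutral default for the maximum. *)
Definition kazhdan_constant S (kappa : R) : Prop :=
  0 < kappa /\
  forall (K : hilbertType R) (rho : {multiplicative G -> unitary K}),
    no_invariant_vectors rho ->
    forall xi : K,
      kappa * rnorm xi <= \big[Num.max/0]_(s <- S) rnorm (rho s xi - xi).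

Definition approx_rep (H : hilbertType R) F (eps : R) (pi : G -> unitary H) :
    Prop :=
  {in F &, forall g h,
     opnorm (fun x => pi (g * h)%g x - (pi g * pi h)%g x) <= eps} /\
  {in F, forall g, pi (g^-1)%g = ((pi g)^-1)%g}.

Definition laplacian (H : hilbertType R) S (pi : G -> unitary H) (x : H) : H :=
  x - (#|` S|%:R : R[i])^-1 *: \sum_(s <- S) pi s x.

End PropertyT.

(* G is a discrete group, so its compact subsets are the finite ones. *)
Definition property_T (R : realType) (G : groupType) : Prop :=
  exists (S : {fset G}) (kappa : R), kazhdan_constant S kappa.

(* Main.v *)
Require Import Defs.
From HB Require Import structures.
From mathcomp Require Import all_boot all_order all_algebra.
From mathcomp Require Import finmap complex ring lra.
From mathcomp Require Import all_classical all_reals all_analysis.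

Set Implicit Arguments.
Unset Strict Implicit.
Unset Printing Implicit Defensive.

Import Order.TTheory GRing.Theory Num.Theory.
Import numFieldNormedType.Exports.

Local Open Scope classical_set_scope.
Local Open Scope complex_scope.
Local Open Scope ring_scope.

(* Let Delta be the Laplacian and phi a function of positive type on G.  Splitting
   off the largest constant that leaves phi of positive type yields a
   representation without invariant vectors, so the Kazhdan inequality gives
   phi(Delta^2) >= mu phi(Delta) for some mu >= lambda.  Here mu > lambda unless
   kappa >= 2, in which case G has at most two elements and everything is explicit.
   Applying this to exp(- t psi) (Schoenberg) and letting t tend to 0 extends the
   inequality to psi conditionally of negative type.

   If ||Delta x||^2 >= lambda <Delta x, x> - C eps ||x||^2 failed for
   approximate representations with F and C arbitrarily large, then the functions
   g |-> (||x||^2 - Re <pi g x, x>) / <Delta x, x> would be conditionally of negative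
   type up to errors tending to 0, and bounded pointwise because S generates G; an
   ultrafilter limit would contradict the strict inequality.  Hence
   Delta^2 - lambda Delta >= - C eps, which bounds z - Delta from below for z outside
   the asserted set. *)

(** A limit retains only weak inequalities, so the gap for exact representations has to be strictly
    larger than the gap claimed. The group of order two with [kappa] = 2 attains equality in its
    sign representation; this is why the case [kappa] >= 2 is treated apart. Only coefficient
    functions pass to the limit: no ultraproduct of the Hilbert spaces is formed, and enlarging F is
    what restores the group law. Dividing by the quadratic form of the Laplacian keeps the limit
    from vanishing, and failure with constant n turns the relative error into O(1/n). The functions
    are real, so GNS produces a real Hilbert space. It is realized as a space of functions, which
    avoids both quotient and completion, and then complexified because Kazhdan constants refer to
    complex representations. Sums over S stay unnormalized until the end; the threshold is then
    kappa^2 / 2, the 2 coming from |rho(s) x - x|^2 = 2 (|x|^2 - Re <rho(s) x, x>). *)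

(** * Elementary inequalities *)

Lemma quadratic_ge0_disc (R : realFieldType) (a b c : R) : 0 <= c ->
  (forall t, 0 <= a + 2 * t * b + t ^+ 2 * c) -> b ^+ 2 <= a * c.
Proof.
rewrite le_eqVlt => /predU1P[<-|c0] h.
  have [->|b0] := eqVneq b 0; first by rewrite expr0n mulr0.
  have := h (- (a + 1) / (2 * b)); rewrite mulr0 addr0.
  rewrite (_ : a + _ = -1); last by field.
  by rewrite lerNr oppr0 ler10.
have := h (- b / c); rewrite (_ : _ + _ = (a * c - b ^+ 2) / c); last first.
  by field; rewrite gt_eqF.
by rewrite pmulr_lge0 ?invr_gt0// subr_ge0.
Qed.

Lemma le_of_sqr (R : realDomainType) (a b : R) :
  0 <= b -> a ^+ 2 <= b ^+ 2 -> a <= b.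
Proof.
move=> b0 ab; rewrite leNgt; apply/negP => ba; move: ab; apply/negP.
by rewrite -ltNge ltr_sqr // nnegrE (le_trans b0) ?ltW.
Qed.

Lemma lt_of_sqr (R : realDomainType) (a b : R) :
  0 <= b -> a ^+ 2 < b ^+ 2 -> a < b.
Proof.
move=> b0 ab; rewrite ltNge; apply/negP => ba; move: ab; apply/negP.
by rewrite -leNgt ler_sqr // nnegrE (le_trans b0).
Qed.

Lemma bigmax_ge_ex (R : realType) (I : eqType) (r : seq I) (F : I -> R) a : 0 < a ->
  a <= \big[Num.max/0]_(i <- r) F i -> exists2 i, i \in r & a <= F i.
Proof.
move=> a0; elim: r => [|i r IHr]; first by rewrite big_nil leNgt a0.
rewrite big_cons le_max => /orP[aF|/IHr[j jr aF]].
  by exists i; rewrite ?mem_head.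
by exists j; rewrite // inE jr orbT.
Qed.

Lemma sum_ge2 (R : realType) (I : eqType) (r : seq I) (F : I -> R) i j :
  uniq r -> (forall i, 0 <= F i) -> i \in r -> j \in r -> i != j ->
  F i + F j <= \sum_(x <- r) F x.
Proof.
move=> ur F0 ir jr ij; rewrite (big_rem i)//= lerD2l.
have jr' : j \in rem i r by rewrite (mem_rem_uniq _ ur) !inE eq_sym ij.
by rewrite (big_rem j)//= lerDl sumr_ge0.
Qed.

Lemma fset_sum_const (R : pzSemiRingType) (K : choiceType) (S : {fset K}) (c : R) :
  \sum_(s <- S) c = #|` S|%:R * c.
Proof.
rewrite -sum1_size natr_sum mulr_suml; apply: eq_bigr => s _; exact/esym/mul1r.
Qed.

Lemma le_of_mulr_sqr (R : realFieldType) (c n w : R) :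
  0 <= n -> 0 <= w -> c * n ^+ 2 <= w * n -> c * n <= w.
Proof.
rewrite le_eqVlt => /predU1P[<-|n0] w0 h; first by rewrite mulr0.
by rewrite -(ler_pM2r n0) -mulrA -expr2.
Qed.

(** Yields the lower bound on the resolvent at the very end: if [w < c * n] with [c] the minimum,
    then [c <= 1] keeps the right side below [c * (1 + K) * n ^+ 2], hence below [d * n ^+ 2]. *)
Lemma le_of_quadratic (R : realFieldType) (d K n w : R) :
  0 < d -> 0 <= K -> 0 <= n -> 0 <= w -> d * n ^+ 2 <= w ^+ 2 + K * w * n ->
  Num.min 1 (d / (1 + K)) * n <= w.
Proof.
move=> d0 K0 n0 w0 h; set c := Num.min _ _.
have K1 : 0 < 1 + K by rewrite ltr_wpDr.
have c0 : 0 < c by rewrite lt_min ltr01 divr_gt0.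
have c1 : c <= 1 by rewrite ge_min lexx.
have cd : c * (1 + K) <= d by rewrite -ler_pdivlMr// ge_min lexx orbT.
rewrite leNgt; apply/negP => wc.
have n1 : 0 < n.
  rewrite lt_neqAle n0 andbT; apply: contraTneq wc => <-.
  by rewrite mulr0 -leNgt.
have h1 : w ^+ 2 < (c * n) ^+ 2 by rewrite ltr_sqr ?nnegrE// mulr_ge0// ltW.
have h2 : K * w * n <= K * (c * n) * n.
  by rewrite ler_wpM2r// ler_wpM2l// ltW.
have h3 : (c * n) ^+ 2 <= c * n ^+ 2.
  by rewrite exprMn ler_wpM2r ?sqr_ge0// expr2 ler_piMl// ltW.
have h4 : c * (1 + K) * n ^+ 2 <= d * n ^+ 2 by rewrite ler_wpM2r ?sqr_ge0.
lra.
Qed.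

(** * Complexification of a real Hilbert space *)

(** Completeness is phrased with the form alone, so that norm and topology need to be built on the
    complexification only. *)
Record realHilbert (R : realType) := RealHilbert {
  rh_car :> lmodType R;
  rh_form : rh_car -> rh_car -> R;
  rh_formC : forall x y, rh_form x y = rh_form y x;
  rh_formP : forall a x y z,
    rh_form (a *: x + y) z = a * rh_form x z + rh_form y z;
  rh_form_ge0 : forall x, 0 <= rh_form x x;
  rh_form_eq0 : forall x, rh_form x x = 0 -> x = 0;
  rh_complete : forall F : set_system rh_car, ProperFilter F ->
    (forall e, 0 < e -> exists x, F [set y | rh_form (x - y) (x - y) < e]) ->
    exists x, forall e, 0 < e -> F [set y | rh_form (x - y) (x - y) < e]
}.

Section Complexification.
Context {R : realType} (V : realHilbert R).

Definition complexification : Type := (V * V)%type.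
HB.instance Definition _ := GRing.Zmodule.on complexification.

Local Notation K := complexification.
Local Notation form := (@rh_form R V).

Let formD x y z : form (x + y) z = form x z + form y z.
Proof. by have := rh_formP 1 x y z; rewrite scale1r mul1r. Qed.
Let form0 z : form 0 z = 0.
Proof. by apply: (addIr (form 0 z)); rewrite -formD !add0r. Qed.
Let formZ a x z : form (a *: x) z = a * form x z.
Proof. by rewrite -[a *: x]addr0 rh_formP form0 addr0. Qed.
Let formN x z : form (- x) z = - form x z.
Proof. by rewrite -scaleN1r formZ mulN1r. Qed.
Let formDr x y z : form z (x + y) = form z x + form z y.
Proof. by rewrite !(rh_formC z) formD. Qed.
Let formZr a x z : form z (a *: x) = a * form z x.
Proof. by rewrite !(rh_formC z) formZ. Qed.
Let formNr x z : form z (- x) = - form z x.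
Proof. by rewrite !(rh_formC z) formN. Qed.

(** The pair [(a, b)] stands for a + i b. *)
Definition cpx_scale (z : R[i]) (x : K) : K :=
  let: (a, b) := (x : V * V) in
  (complex.Re z *: a - complex.Im z *: b, complex.Re z *: b + complex.Im z *: a).

Lemma cpx_scaleA a b x : cpx_scale a (cpx_scale b x) = cpx_scale (a * b) x.
Proof.
case: a b x => [a1 a2] [b1 b2] [x1 x2]; rewrite /cpx_scale/=.
congr pair => /=.
  rewrite !(scalerDr, scalerDl, scalerBl, scalerN, scalerA, opprD).
  by rewrite scaleNr [RHS](AC (2*2) ((1*3)*(4*2))).
rewrite !(scalerDr, scalerDl, scalerBl, scalerN, scalerA, opprD).
by rewrite scaleNr [RHS](AC (2*2) ((1*3)*(4*2))).
Qed.

Lemma cpx_scale1 : left_id 1 cpx_scale.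
Proof. by case=> x1 x2; rewrite /cpx_scale/= !scale1r !scale0r subr0 addr0. Qed.

Lemma cpx_scaleDr : right_distributive cpx_scale +%R.
Proof.
move=> [a1 a2] [x1 x2] [y1 y2]; rewrite /cpx_scale/=; congr pair => /=.
  by rewrite !scalerDr opprD addrACA.
by rewrite !scalerDr addrACA.
Qed.

Lemma cpx_scaleDl x : {morph cpx_scale^~ x : a b / a + b}.
Proof.
case: x => [x1 x2] [a1 a2] [b1 b2]; rewrite /cpx_scale/=; congr pair => /=.
  by rewrite !scalerDl opprD addrACA.
by rewrite !scalerDl addrACA.
Qed.

HB.instance Definition _ := GRing.Zmodule_isLmodule.Build R[i] K
  cpx_scaleA cpx_scale1 cpx_scaleDr cpx_scaleDl.

Definition cpx_sqnorm (x : K) : R := form x.1 x.1 + form x.2 x.2.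

Definition cpx_norm (x : K) : R[i] := (Num.sqrt (cpx_sqnorm x))%:C.

Lemma cpx_sqnorm_ge0 x : 0 <= cpx_sqnorm x.
Proof. by rewrite addr_ge0// rh_form_ge0. Qed.

Definition cpx_inner (x y : K) : R[i] :=
  (form x.1 y.1 + form x.2 y.2) +i* (form x.2 y.1 - form x.1 y.2).

Lemma cpx_normD x y : cpx_norm (x + y) <= cpx_norm x + cpx_norm y.
Proof.
rewrite /cpx_norm -rmorphD/= lecR -(@ler_pXn2r _ 2)// ?nnegrE ?addr_ge0//.
rewrite sqrrD !sqr_sqrtr ?cpx_sqnorm_ge0// -sqrtrM ?cpx_sqnorm_ge0//.
pose b := form x.1 y.1 + form x.2 y.2.
(* Nonnegativity of this quadratic in [t] is Cauchy-Schwarz for the real part of the inner product,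
   which is all the triangle inequality needs. *)
have qE t : cpx_sqnorm (x + (t%:C : R[i]) *: y) =
    cpx_sqnorm x + 2 * t * b + t ^+ 2 * cpx_sqnorm y.
  case: x y @b => [x1 x2] [y1 y2]; rewrite /cpx_sqnorm/= !scale0r subr0 addr0.
  rewrite !(formD, formDr, formZ, formZr) (rh_formC y1) (rh_formC y2); ring.
have := qE 1; rewrite (_ : (1 : R)%:C = 1)// scale1r => ->.
rewrite mulr1 expr1n mul1r lerD2r lerD2l mulr_natl ler_pMn2r//.
apply: (le_trans (ler_norm _)); rewrite -sqrtr_sqr ler_wsqrtr//.
apply: quadratic_ge0_disc => [|t]; first exact: cpx_sqnorm_ge0.
by rewrite -qE cpx_sqnorm_ge0.
Qed.

Lemma cpx_normZ (z : R[i]) x : cpx_norm (z *: x) = `|z| * cpx_norm x.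
Proof.
rewrite /cpx_norm normc_def -rmorphM/=; congr (_%:C).
rewrite -sqrtrM ?addr_ge0 ?sqr_ge0//; congr Num.sqrt.
case: z x => [a b] [x y]; rewrite /cpx_sqnorm/=.
rewrite !(formD, formDr, formZ, formZr, formN, formNr) (rh_formC y x); ring.
Qed.

Lemma cpx_norm_eq0 x : cpx_norm x = 0 -> x = 0.
Proof.
move=> /complexI/eqP; rewrite sqrtr_eq0 => le0.
have /eqP : cpx_sqnorm x = 0 by apply/eqP; rewrite eq_le le0 cpx_sqnorm_ge0.
rewrite paddr_eq0 ?rh_form_ge0// => /andP[/eqP/rh_form_eq0 x1 /eqP/rh_form_eq0].
by case: x x1 {le0} => [? ?] /= -> ->.
Qed.

HB.instance Definition _ := Lmodule_isNormed.Build R[i] K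
  cpx_normD cpx_normZ cpx_norm_eq0.

Lemma cpx_normE (x : K) : `|x| = (Num.sqrt (cpx_sqnorm x))%:C.
Proof. by []. Qed.

Lemma cpx_ballP (x y : K) (e : R) : 0 < e ->
  ball x e%:C y <-> cpx_sqnorm (x - y) < e ^+ 2.
Proof.
move=> e0; rewrite -ball_normE/= cpx_normE ltcR.
by rewrite -{1}(ger0_norm (ltW e0)) -sqrtr_sqr ltr_sqrt// exprn_gt0.
Qed.

Lemma cpx_complete (F : set_system K) : ProperFilter F -> cauchy F -> cvg F.
Proof.
move=> FF /cauchyP cF.
have cF' e : 0 < e -> exists x : K, F [set y | cpx_sqnorm (x - y) < e].
  move=> e0; have := cF (Num.sqrt e)%:C; rewrite ltcR sqrtr_gt0 e0 => -[//|x].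
  move=> Fx; exists x; apply: filterS Fx => y /cpx_ballP.
  by rewrite sqrtr_gt0 e0 sqr_sqrtr ?ltW//; exact.
have ge_fst (x : K) : form x.1 x.1 <= cpx_sqnorm x by rewrite lerDl rh_form_ge0.
have ge_snd (x : K) : form x.2 x.2 <= cpx_sqnorm x by rewrite lerDr rh_form_ge0.
have [x1 x1F] : exists x, forall e, 0 < e ->
    F [set y : K | form (x - y.1) (x - y.1) < e].
  apply: (@rh_complete _ V (fst @ F)) => e /cF'[x Fx]; exists x.1.
  apply: (@filterS _ F _ _ _ _ Fx) => y; exact: le_lt_trans (ge_fst (x - y)).
have [x2 x2F] : exists x, forall e, 0 < e ->
    F [set y : K | form (x - y.2) (x - y.2) < e].
  apply: (@rh_complete _ V (snd @ F)) => e /cF'[x Fx]; exists x.2.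
  apply: (@filterS _ F _ _ _ _ Fx) => y; exact: le_lt_trans (ge_snd (x - y)).
apply/cvg_ex; exists ((x1, x2) : K); apply/cvg_ballP => e e0.
have [e' e'E] : exists e', e = e'%:C.
  by exists (complex.Re e); rewrite RRe_real// gtr0_real.
move: e0; rewrite e'E ltcR => e0.
have e2 : 0 < e' ^+ 2 / 2 by rewrite divr_gt0// exprn_gt0.
near=> y; apply/cpx_ballP => //; rewrite [_ ^+ 2]splitr ltrD//.
  by near: y; exact: x1F.
by near: y; exact: x2F.
Unshelve. all: by end_near. Qed.

HB.instance Definition _ := Uniform_isComplete.Build K cpx_complete.

Lemma cpx_inner_bilinear :
  bilinear_for (GRing.Scale.Law.clone _ _ *%R _)
    (GRing.Scale.Law.clone _ _ (Num.conj \; *%R) _) cpx_inner.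
Proof.
split=> [[y1 y2] [a b] [x1 x2] [z1 z2] | [x1 x2] [a b] [y1 y2] [z1 z2]].
  rewrite /cpx_inner/= !(formD, formDr, formZ, formZr, formN, formNr).
  by apply/eqP; rewrite eq_complex/=; apply/andP; split; apply/eqP; ring.
rewrite /cpx_inner/= !(formD, formDr, formZ, formZr, formN, formNr).
by apply/eqP; rewrite eq_complex/=; apply/andP; split; apply/eqP; ring.
Qed.

HB.instance Definition _ := bilinear_isBilinear.Build R[i] K K R[i]
  _ _ cpx_inner cpx_inner_bilinear.

Lemma cpx_inner_herm x y :
  cpx_inner x y = (-1) ^+ false * Num.conj (cpx_inner y x).
Proof.
rewrite expr0 mul1r; apply/eqP; rewrite eq_complex/= !(rh_formC y.1).
by rewrite !(rh_formC y.2) eqxx opprB eqxx.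
Qed.

HB.instance Definition _ := isHermitianSesquilinear.Build R[i] K false
  Num.conj cpx_inner cpx_inner_herm.

Lemma cpx_innerE x : cpx_inner x x = (cpx_sqnorm x)%:C.
Proof. by rewrite /cpx_inner rh_formC subrr. Qed.

Lemma cpx_inner_gt0 (x : K) : x != 0 -> 0 < cpx_inner x x.
Proof.
move=> x0; rewrite cpx_innerE ltcR lt_neqAle cpx_sqnorm_ge0 andbT eq_sym.
apply: contra x0 => /eqP xx; apply/eqP/cpx_norm_eq0.
by rewrite /cpx_norm xx sqrtr0.
Qed.

HB.instance Definition _ := isDotProduct.Build R[i] K cpx_inner cpx_inner_gt0.

Lemma cpx_sqr_norm_inner (x : K) : `|x| ^+ 2 = cpx_inner x x.
Proof.
by rewrite cpx_innerE cpx_normE -rmorphXn/= sqr_sqrtr// cpx_sqnorm_ge0.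
Qed.

HB.instance Definition _ := CompleteNormedModule_isHilbert.Build R K
  cpx_sqr_norm_inner.

End Complexification.

(** * Reproducing kernel Hilbert spaces *)

Section JordanVonNeumann.
Context {R : realType} {V : lmodType R} (N : V -> R).
Hypothesis N_ge0 : forall x, 0 <= N x.
Hypothesis NZ : forall t x, N (t *: x) = t ^+ 2 * N x.
Hypothesis N_parallelogram : forall x y,
  N (x + y) + N (x - y) = 2 * N x + 2 * N y.

Definition polar (x y : V) : R := (N (x + y) - N (x - y)) / 4.

Let NN x : N (- x) = N x.
Proof. by rewrite -scaleN1r NZ sqrrN expr1n mul1r. Qed.

Lemma polarC x y : polar x y = polar y x.
Proof. by rewrite /polar [x + y]addrC -(NN (x - y)) opprB. Qed.

Lemma polar_diag x : polar x x = N x.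
Proof.
rewrite /polar subrr -(scale0r x) NZ expr0n mul0r subr0.
by rewrite -mulr2n -scaler_nat NZ; field.
Qed.

Let N0 : N 0 = 0. Proof. by rewrite -(scale0r 0) NZ expr0n mul0r. Qed.

Lemma polar0 x : polar 0 x = 0.
Proof. by rewrite /polar add0r sub0r NN subrr mul0r. Qed.

Lemma polar_double x y z : polar (x + y) z + polar (x - y) z = 2 * polar x z.
Proof.
have := N_parallelogram (x + z) y; have := N_parallelogram (x - z) y.
rewrite (addrAC x z y) (addrAC x z (- y)) (addrAC x (- z) y).
rewrite (addrAC x (- z) (- y)) /polar => h1 h2.
lra.
Qed.

(** Half the sum and half the difference of [x] and [y] are the right arguments for [polar_double],
    since they add up to [x] and differ by [y]. *)
Lemma polarD x y z : polar (x + y) z = polar x z + polar y z.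
Proof.
have h2 u v : polar (u + u) v = 2 * polar u v.
  by have := polar_double u u v; rewrite subrr polar0 addr0.
have half (u : V) : 2^-1 *: u + 2^-1 *: u = u.
  by rewrite -scalerDl (_ : _ + _ = 1) ?scale1r//; field.
have := polar_double (2^-1 *: (x + y)) (2^-1 *: (x - y)) z.
rewrite -h2 half !scalerDr !scalerN addrACA subrr addr0 half.
by rewrite opprD opprK addrACA subrr add0r half => ->.
Qed.

(* t |-> polar (t x) y - t polar x y is additive, 1-periodic and bounded on [0, 1]. *)
Lemma polarZ t x y : polar (t *: x) y = t * polar x y.
Proof.
pose phi t := polar (t *: x) y - t * polar x y.
have phiD s u : phi (s + u) = phi s + phi u.
  by rewrite /phi scalerDl polarD; ring.
have phi1 : phi 1 = 0 by rewrite /phi scale1r mul1r subrr.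
have phi0 : phi 0 = 0 by apply: (addIr (phi 0)); rewrite -phiD !add0r.
have phiN s : phi (- s) = - phi s.
  by apply/eqP; rewrite -addr_eq0 -phiD addNr phi0.
have phin n s : phi (s *+ n) = phi s *+ n.
  by elim: n => [|n IHn]; rewrite ?phi0// !mulrS phiD IHn.
have phiz (m : int) : phi m%:~R = 0.
  by case: m => n; rewrite ?NegzE ?mulrNz ?phiN -pmulrn phin phi1 mul0rn ?oppr0.
(* Without Cauchy-Schwarz at hand, the parallelogram identity and [N_ge0] alone give |polar u y| <=
   (N u + N y) / 2. *)
pose M := (N x + N y) / 2 + `|polar x y|.
have phiM s : `|phi s| <= M.
  rewrite -(subrK (Num.floor s)%:~R s) phiD phiz addr0.
  set f := s - _; have f01 : 0 <= f <= 1.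
    by have /andP[h1 h2] := floor_itv s; rewrite subr_ge0 h1 lerBlDl -intrD1 ltW.
  have f2 : f ^+ 2 <= 1 by case/andP: f01 => f0 f1; rewrite expr_le1.
  apply: le_trans (ler_normB _ _) _; apply: lerD; last first.
    case/andP: f01 => f0 f1; rewrite normrM ger0_norm// ler_piMl//.
  have := N_parallelogram (f *: x) y; rewrite NZ => pe.
  have := N_ge0 (f *: x + y); have := N_ge0 (f *: x - y); have := N_ge0 x.
  rewrite /polar ler_norml => *; apply/andP; split; nra.
suff: phi t = 0 by move/eqP; rewrite subr_eq0 => /eqP.
apply/eqP; rewrite -normr_le0 leNgt; apply/negP => t0.
have := phiM (t *+ (Num.truncn (M / `|phi t|)).+1).
rewrite phin normrMn -mulr_natl leNgt -ltr_pdivrMr//.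
by rewrite truncnS_gt.
Qed.

End JordanVonNeumann.

(** * Positive semidefinite kernels *)

Section PositiveKernels.
Context {R : realType} {X : Type}.
Implicit Types (k : X -> X -> R) (f g : X -> R) (l m : seq (R * X)).

(** A list of weighted points, repetitions allowed, is a formal combination of points; concatenation
    and rescaling replace the vector space operations and need no equality test on [X]. *)
Definition lincomb f l : R := \sum_(p <- l) p.1 * f p.2.

Definition kform k l m : R := lincomb (fun x => lincomb (k x) m) l.

Definition lscale t l : seq (R * X) := [seq (t * p.1, p.2) | p <- l].

Lemma lincomb_cat f l m : lincomb f (l ++ m) = lincomb f l + lincomb f m.
Proof. exact: big_cat. Qed.

Lemma lincomb_scale f t l : lincomb f (lscale t l) = t * lincomb f l.
Proof.
by rewrite /lincomb big_map mulr_sumr; apply: eq_bigr => p _; rewrite mulrA.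
Qed.

Lemma lincombD f g l : lincomb (f \+ g) l = lincomb f l + lincomb g l.
Proof. by rewrite -big_split; apply: eq_bigr => p _; exact: mulrDr. Qed.

Lemma lincombZ t f l : lincomb (fun x => t * f x) l = t * lincomb f l.
Proof. by rewrite mulr_sumr; apply: eq_bigr => p _; exact: mulrCA. Qed.

Lemma lincombB f g l : lincomb (f \- g) l = lincomb f l - lincomb g l.
Proof. by rewrite -sumrB; apply: eq_bigr => p _; exact: mulrBr. Qed.

Lemma lincomb_const b l : lincomb (fun=> b) l = b * lincomb (fun=> 1) l.
Proof. by rewrite -lincombZ; apply: eq_bigr => p _; rewrite mulr1. Qed.

Lemma eq_lincomb f g l : f =1 g -> lincomb f l = lincomb g l.
Proof. by move=> fg; apply: eq_bigr => p _; rewrite fg. Qed.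

Lemma kform_catl k l l' m : kform k (l ++ l') m = kform k l m + kform k l' m.
Proof. exact: lincomb_cat. Qed.

Lemma kform_catr k l m m' : kform k l (m ++ m') = kform k l m + kform k l m'.
Proof. by rewrite -lincombD; apply: eq_lincomb => x; exact: lincomb_cat. Qed.

Lemma kform_scalel k t l m : kform k (lscale t l) m = t * kform k l m.
Proof. exact: lincomb_scale. Qed.

Lemma kform_scaler k t l m : kform k l (lscale t m) = t * kform k l m.
Proof. by rewrite -lincombZ; apply: eq_lincomb => x; exact: lincomb_scale. Qed.

Lemma cvg_lincomb T (F : set_system T) {FF : Filter F} (f : T -> X -> R) g l :
  (forall x, f i x @[i --> F] --> g x) ->
  lincomb (f i) l @[i --> F] --> lincomb g l.
Proof.
move=> fg; elim: l => [|p l IHl].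
  by rewrite /lincomb big_nil; under eq_fun do rewrite big_nil; exact: cvg_cst.
rewrite /lincomb big_cons; under eq_fun do rewrite big_cons.
by apply: cvgD IHl; apply: cvgM; [exact: cvg_cst|exact: fg].
Qed.

Definition psd k := forall l, 0 <= kform k l l.

End PositiveKernels.

Record pdkernel (R : realType) (X : Type) := PDKernel {
  pdk :> X -> X -> R;
  pdkC : forall x y, pdk x y = pdk y x;
  pdk_psd : psd pdk
}.

(** * The norm defined by a kernel *)

Section RealRKHS.
Context {R : realType} {X : Type} (k : pdkernel R X).
Implicit Types (f g : X -> R) (l m : seq (R * X)).

Local Notation q l := (kform k l l).

Lemma kformC l m : kform k l m = kform k m l.
Proof.
rewrite /kform /lincomb; under eq_bigr do rewrite mulr_sumr.
rewrite exchange_big; apply: eq_bigr => p _; rewrite mulr_sumr.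
by apply: eq_bigr => r _; rewrite pdkC mulrCA.
Qed.

Definition rkhs_bounded f :=
  exists M, forall l, 2 * lincomb f l - q l <= M.

(* [||f||^2] is the supremum of [2 <f, v> - ||v||^2]; letting [v] range over the
   span of the [k x] gives the norm without any completion. *)
Definition rkhs_sqnorm f : R :=
  sup [set 2 * lincomb f l - q l | l in [set: seq (R * X)]].

Local Notation N := rkhs_sqnorm.

Lemma rkhs_sqnorm_ub f l : rkhs_bounded f -> 2 * lincomb f l - q l <= N f.
Proof.
move=> [M fM]; apply: ub_le_sup; last by exists l.
by exists M => _ [m _ <-].
Qed.

Lemma rkhs_sqnorm_le f M :
  (forall l, 2 * lincomb f l - q l <= M) -> N f <= M.
Proof.
move=> fM; apply: ge_sup; last by move=> _ [l _ <-].
by exists (2 * lincomb f [::] - q [::]); exists [::].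
Qed.

Lemma rkhs_sqnorm_ge0 f : rkhs_bounded f -> 0 <= N f.
Proof.
move=> bf; apply: le_trans (rkhs_sqnorm_ub [::] bf).
by rewrite /kform /lincomb !big_nil mulr0 subr0.
Qed.

(** Test [f] on the half sum of [l] and [m], and [g] on their half difference: the cross terms in
    [kform k l m] cancel. *)
Let parallelogram_pre f g l m : rkhs_bounded f -> rkhs_bounded g ->
  (2 * lincomb (f \+ g) l - q l) + (2 * lincomb (f \- g) m - q m) <=
  2 * N f + 2 * N g.
Proof.
move=> bf bg.
have := rkhs_sqnorm_ub (lscale 2^-1 (l ++ m)) bf.
have := rkhs_sqnorm_ub (lscale 2^-1 (l ++ lscale (-1) m)) bg.
rewrite !(lincomb_scale, lincomb_cat, kform_scalel, kform_scaler, kform_catl,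
  kform_catr, lincombD, lincombB) (kformC m l); lra.
Qed.

Lemma rkhs_boundedD f g :
  rkhs_bounded f -> rkhs_bounded g -> rkhs_bounded (f \+ g).
Proof.
move=> bf bg; exists (2 * N f + 2 * N g) => l.
have := parallelogram_pre l [::] bf bg.
by rewrite /kform [X in 2 * X]/lincomb /lincomb !big_nil mulr0 subr0 addr0.
Qed.

Lemma rkhs_boundedZ t f : rkhs_bounded f -> rkhs_bounded (fun x => t * f x).
Proof.
move=> bf; have [->|t0] := eqVneq t 0.
  exists 0 => l; rewrite lincombZ mul0r mulr0 sub0r oppr_le0; exact: pdk_psd.
exists (t ^+ 2 * N f) => l.
have := rkhs_sqnorm_ub (lscale t^-1 l) bf.
rewrite lincomb_scale kform_scalel kform_scaler lincombZ.
rewrite -(ler_pM2l (_ : 0 < t ^+ 2)) ?exprn_even_gt0//.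
by apply: le_trans; rewrite le_eqVlt; apply/orP; left; apply/eqP; field.
Qed.

Lemma rkhs_sqnormZ t f : rkhs_bounded f -> N (fun x => t * f x) = t ^+ 2 * N f.
Proof.
have le s h : rkhs_bounded h -> N (fun x => s * h x) <= s ^+ 2 * N h.
  move=> bh; apply: rkhs_sqnorm_le => l; have [->|s0] := eqVneq s 0.
    by rewrite lincombZ mul0r mulr0 sub0r expr0n mul0r oppr_le0; exact: pdk_psd.
  have := rkhs_sqnorm_ub (lscale s^-1 l) bh.
  rewrite lincomb_scale kform_scalel kform_scaler lincombZ.
  rewrite -(ler_pM2l (_ : 0 < s ^+ 2)) ?exprn_even_gt0//.
  by apply: le_trans; rewrite le_eqVlt; apply/orP; left; apply/eqP; field.
move=> bf; apply/eqP; rewrite eq_le le//=.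
have [->|t0] := eqVneq t 0.
  by rewrite expr0n mul0r rkhs_sqnorm_ge0//; exact: rkhs_boundedZ.
have := le t^-1 _ (rkhs_boundedZ t bf).
rewrite (_ : (fun x => _) = f); last by apply/funext => x; rewrite mulKf.
by rewrite exprVn -ler_pdivlMl ?invrK ?exprn_even_gt0.
Qed.

Lemma rkhs_parallelogram f g : rkhs_bounded f -> rkhs_bounded g ->
  N (f \+ g) + N (f \- g) = 2 * N f + 2 * N g.
Proof.
have bB u v : rkhs_bounded u -> rkhs_bounded v -> rkhs_bounded (u \- v).
  move=> bu bv; rewrite (_ : u \- v = u \+ (fun x => -1 * v x)).
    exact/rkhs_boundedD/rkhs_boundedZ.
  by apply/funext => x /=; rewrite mulN1r.
have le u v : rkhs_bounded u -> rkhs_bounded v ->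
    N (u \+ v) + N (u \- v) <= 2 * N u + 2 * N v.
  move=> bu bv; rewrite -lerBrDr; apply: rkhs_sqnorm_le => l.
  rewrite lerBrDr -lerBrDl; apply: rkhs_sqnorm_le => m.
  by rewrite lerBrDl; exact: parallelogram_pre.
move=> bf bg; apply/eqP; rewrite eq_le le//=.
(* The reverse inequality is the same one for [f + g] and [f - g], whose own sum and difference are
   [2 f] and [2 g]. *)
have := le _ _ (rkhs_boundedD bf bg) (bB _ _ bf bg).
rewrite (_ : _ \+ _ = (fun x => 2 * f x)); last by apply/funext => x /=; ring.
rewrite (_ : _ \- _ = (fun x => 2 * g x)); last by apply/funext => x /=; ring.
rewrite !rkhs_sqnormZ//; lra.
Qed.

Lemma rkhs_eval f x : rkhs_bounded f -> f x ^+ 2 <= k x x * N f.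
Proof.
move=> bf; rewrite mulrC; apply: quadratic_ge0_disc => [|t].
  by have := pdk_psd k [:: (1, x)]; rewrite /kform /lincomb !big_seq1/= !mul1r.
have := rkhs_sqnorm_ub [:: (- t, x)] bf.
by rewrite /kform /lincomb !big_seq1/=; lra.
Qed.

Lemma kform_rcons l s x : q (l ++ [:: (s, x)]) =
  q l + 2 * s * lincomb (k x) l + s ^+ 2 * k x x.
Proof.
rewrite kform_catl !kform_catr (kformC l) /kform /lincomb !big_seq1/=; ring.
Qed.

Lemma rkhs_bounded_kernel x : rkhs_bounded (k x).
Proof.
exists (k x x) => l; have := pdk_psd k (l ++ [:: (-1, x)]).
by rewrite kform_rcons; lra.
Qed.

(* [k x] reproduces the value at [x]: shift the combination by [x] in the supremum. *)
Lemma rkhs_sqnormD_kernel f x t : rkhs_bounded f ->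
  N (fun y => f y + t * k x y) = N f + 2 * t * f x + t ^+ 2 * k x x.
Proof.
move=> bf.
have lE g l s : lincomb g (l ++ [:: (s, x)]) = lincomb g l + s * g x.
  by rewrite lincomb_cat /lincomb big_seq1.
apply/eqP; rewrite eq_le; apply/andP; split.
  apply: rkhs_sqnorm_le => l; have := rkhs_sqnorm_ub (l ++ [:: (- t, x)]) bf.
  rewrite kform_rcons lE lincombD lincombZ; lra.
rewrite -lerBrDr -lerBrDr; apply: rkhs_sqnorm_le => l; rewrite !lerBrDr.
have : rkhs_bounded (f \+ (fun y => t * k x y)).
  exact/rkhs_boundedD/rkhs_boundedZ/rkhs_bounded_kernel.
move=> /(rkhs_sqnorm_ub (l ++ [:: (t, x)])); apply: le_trans.
rewrite kform_rcons lE lincombD lincombZ/=; lra.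
Qed.

End RealRKHS.

Section RKHSType.
Context {R : realType} {X : Type} (k : pdkernel R X).

Definition rkhs_pred : {pred X -> R} := fun f => `[< rkhs_bounded k f >].

Lemma rkhs_predP f : reflect (rkhs_bounded k f) (f \in rkhs_pred).
Proof. exact: asboolP. Qed.

Lemma rkhs_bounded0 : rkhs_bounded k 0.
Proof.
exists 0 => l; rewrite (eq_lincomb (g := fun x => 0 * 0 x)) => [|x].
  by rewrite lincombZ mul0r mulr0 sub0r oppr_le0; exact: pdk_psd.
by rewrite mul0r.
Qed.

Lemma rkhs_submod_closed : submod_closed rkhs_pred.
Proof.
split; first by apply/rkhs_predP; exact: rkhs_bounded0.
move=> t f g /rkhs_predP bf /rkhs_predP bg; apply/rkhs_predP.
exact: (rkhs_boundedD (rkhs_boundedZ t bf) bg).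
Qed.

HB.instance Definition _ :=
  GRing.isSubmodClosed.Build R (X -> R) rkhs_pred rkhs_submod_closed.

Structure rkhs := RKHS { rkhs_fun :> X -> R; _ : rkhs_fun \in rkhs_pred }.

HB.instance Definition _ := [isSub for rkhs_fun].
HB.instance Definition _ := [Choice of rkhs by <:].
HB.instance Definition _ := [SubChoice_isSubLmodule of rkhs by <:].

Lemma rkhsP (f : rkhs) : rkhs_bounded k f.
Proof. by apply/rkhs_predP; case: f. Qed.

Lemma rkhs_ext (f g : rkhs) : f =1 g -> f = g.
Proof. by move=> /funext fg; exact: val_inj. Qed.

Definition rkhs_norm2 (f : rkhs) : R := rkhs_sqnorm k f.

Let N_ge0 (f : rkhs) : 0 <= rkhs_norm2 f.
Proof. exact: rkhs_sqnorm_ge0 (rkhsP f). Qed.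

Let NZ t (f : rkhs) : rkhs_norm2 (t *: f) = t ^+ 2 * rkhs_norm2 f.
Proof. exact: rkhs_sqnormZ (rkhsP f). Qed.

Let NN (f : rkhs) : rkhs_norm2 (- f) = rkhs_norm2 f.
Proof. by rewrite -scaleN1r NZ sqrrN expr1n mul1r. Qed.

Let N_parallelogram (f g : rkhs) :
  rkhs_norm2 (f + g) + rkhs_norm2 (f - g) = 2 * rkhs_norm2 f + 2 * rkhs_norm2 g.
Proof. exact: rkhs_parallelogram (rkhsP f) (rkhsP g). Qed.

Definition rkhs_form : rkhs -> rkhs -> R := polar rkhs_norm2.

Lemma rkhs_formC f g : rkhs_form f g = rkhs_form g f.
Proof. exact: polarC. Qed.

Lemma rkhs_form_diag f : rkhs_form f f = rkhs_norm2 f.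
Proof. exact: polar_diag. Qed.

Lemma rkhs_formP a f g h :
  rkhs_form (a *: f + g) h = a * rkhs_form f h + rkhs_form g h.
Proof. by rewrite /rkhs_form polarD// polarZ. Qed.

Lemma rkhs_form_ge0 f : 0 <= rkhs_form f f.
Proof. by rewrite rkhs_form_diag. Qed.

Lemma rkhs_form_eq0 f : rkhs_form f f = 0 -> f = 0.
Proof.
rewrite rkhs_form_diag => f0; apply: rkhs_ext => x.
apply/eqP; rewrite -sqrf_eq0 eq_le sqr_ge0 andbT.
by apply: le_trans (rkhs_eval x (rkhsP f)) _; rewrite [rkhs_sqnorm _ _]f0 mulr0.
Qed.

(** By [rkhs_eval] a Cauchy filter converges pointwise. The squared norm is a supremum of
    expressions that involve finitely many values each, so a bound on it survives pointwise limits;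
    hence the pointwise limit lies in the space and is the limit in norm. *)
Lemma rkhs_form_complete (F : set_system rkhs) : ProperFilter F ->
  (forall e, 0 < e -> exists f, F [set g | rkhs_form (f - g) (f - g) < e]) ->
  exists f, forall e, 0 < e -> F [set g | rkhs_form (f - g) (f - g) < e].
Proof.
move=> FF cF.
have cE x : cvg ((fun f : rkhs => f x) @ F).
  apply: cauchy_cvg; apply/cauchyP => e e0.
  have k0 : 0 <= k x x.
    by have := pdk_psd k [:: (1, x)]; rewrite /kform /lincomb !big_seq1/= !mul1r.
  have d0 : 0 < e ^+ 2 / (k x x + 1) by rewrite divr_gt0 ?exprn_gt0// ltr_wpDl.
  have [f Ff] := cF _ d0; exists (f x); apply: (@filterS _ F _ _ _ _ Ff) => g.
  rewrite /= rkhs_form_diag => fg; rewrite -ball_normE/=.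
  rewrite -ltr_sqr ?nnegrE ?(ltW e0)// real_normK ?num_real//.
  apply: le_lt_trans (rkhs_eval x (rkhsP (f - g))) _.
  rewrite -[rkhs_sqnorm _ _]/(rkhs_norm2 (f - g)).
  apply: le_lt_trans (_ : _ <= (k x x + 1) * rkhs_norm2 (f - g)) _.
    by rewrite ler_wpM2r// lerDl.
  by rewrite mulrC -ltr_pdivlMr// ltr_wpDl.
pose f x := lim ((fun f : rkhs => f x) @ F).
have fl l : (fun h : rkhs => lincomb h l) @ F --> lincomb f l.
  by apply: (@cvg_lincomb _ _ _ _ _ (fun h : rkhs => h : X -> R)) => x; exact: cE.
have key e : 0 < e -> exists2 h : rkhs, F [set g | rkhs_norm2 (h - g) < e] &
    forall l, 2 * lincomb (f \- h) l - kform k l l <= e.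
  move=> e0; have [h Fh] := cF _ e0; exists h.
    by apply: filterS Fh => g /=; rewrite rkhs_form_diag.
  move=> l; rewrite lincombB.
  have hl : (fun g : rkhs => 2 * (lincomb g l - lincomb h l) - kform k l l) @ F
      --> 2 * (lincomb f l - lincomb h l) - kform k l l.
    apply: cvgB; last exact: cvg_cst.
    by apply: cvgM; [exact: cvg_cst|apply: cvgB; [exact: fl|exact: cvg_cst]].
  apply: (cvgr_to_le hl).
  apply: filterS Fh => g /=; rewrite rkhs_form_diag -lincombB => gh.
  apply: le_trans (ltW gh); rewrite /rkhs_norm2.
  rewrite -[rkhs_sqnorm _ _]/(rkhs_norm2 (h - g)) -NN opprB.
  exact: rkhs_sqnorm_ub (rkhsP (g - h)).
have bf : f \in rkhs_pred.
  apply/rkhs_predP; have [h _ hf] := key 1 ltr01.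
  rewrite (_ : f = (f \- h) \+ h); last by apply/funext => x /=; rewrite subrK.
  by apply: rkhs_boundedD (rkhsP h); exists 1.
(* The parallelogram identity puts a factor 2 on each of the two terms, hence the quarter. *)
exists (RKHS bf) => e e0; have e4 : 0 < e / 4 by rewrite divr_gt0.
have [h Fh hf] := key _ e4; apply: filterS Fh => g /= hg.
rewrite rkhs_form_diag (_ : _ - g = (RKHS bf - h) + (h - g)); last first.
  by rewrite addrA subrK.
have := N_parallelogram (RKHS bf - h) (h - g).
have := N_ge0 (RKHS bf - h - (h - g)).
have : rkhs_norm2 (RKHS bf - h) <= e / 4 by exact: rkhs_sqnorm_le.
lra.
Qed.

Definition rkhs_realHilbert : realHilbert R :=
  RealHilbert rkhs_formC rkhs_formP rkhs_form_ge0 rkhs_form_eq0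
    rkhs_form_complete.

Definition rkhs_kernel x : rkhs :=
  RKHS (introT (rkhs_predP _) (rkhs_bounded_kernel k x)).

Lemma rkhs_form_kernel f x : rkhs_form f (rkhs_kernel x) = f x.
Proof.
have E t : rkhs_norm2 (f + t *: rkhs_kernel x) =
    rkhs_norm2 f + 2 * t * f x + t ^+ 2 * k x x.
  exact: rkhs_sqnormD_kernel (rkhsP f).
have := E 1; have := E (-1); rewrite scale1r scaleN1r /rkhs_form /polar => -> ->.
by field.
Qed.

End RKHSType.

(** * The GNS representation of a function of positive type *)

Section RealInnerProduct.
Context {R : realType} {H : hilbertType R}.
Implicit Types x y z : H.

Lemma innerDl x y z : inner (x + y) z = inner x z + inner y z.
Proof. exact: linearDl. Qed.

Lemma innerZl a x y : inner (a *: x) y = a * inner x y.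
Proof. exact: linearZl_LR. Qed.

Lemma innerC x y : inner x y = Num.conj (inner y x).
Proof.
by have := hermitian_subproof (s := @inner R H) x y; rewrite expr0 mul1r.
Qed.

Definition rinner x y : R := complex.Re (inner x y).

Lemma rinnerC x y : rinner x y = rinner y x.
Proof.
by rewrite /rinner innerC; case: (inner y x).
Qed.

Lemma rinnerDl x y z : rinner (x + y) z = rinner x z + rinner y z.
Proof. by rewrite /rinner innerDl; case: (inner x z); case: (inner y z). Qed.

Lemma rinnerZl (a : R) x y : rinner (a%:C *: x) y = a * rinner x y.
Proof.
by rewrite /rinner innerZl; case: (inner x y) => b c /=; rewrite mul0r subr0.
Qed.

Lemma rinnerNl x y : rinner (- x) y = - rinner x y.
Proof.
rewrite -scaleN1r (_ : -1 = (-1 : R)%:C); last by rewrite rmorphN1.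
by rewrite rinnerZl mulN1r.
Qed.

Lemma rinnerDr x y z : rinner z (x + y) = rinner z x + rinner z y.
Proof. by rewrite !(rinnerC z) rinnerDl. Qed.

Lemma rinnerZr (a : R) x y : rinner x (a%:C *: y) = a * rinner x y.
Proof. by rewrite !(rinnerC x) rinnerZl. Qed.

Lemma rinnerNr x y : rinner y (- x) = - rinner y x.
Proof. by rewrite !(rinnerC y) rinnerNl. Qed.

Lemma rinnerBl x y z : rinner (x - y) z = rinner x z - rinner y z.
Proof. by rewrite rinnerDl rinnerNl. Qed.

Lemma rinnerBr x y z : rinner z (x - y) = rinner z x - rinner z y.
Proof. by rewrite rinnerDr rinnerNr. Qed.

Lemma rinner0l x : rinner 0 x = 0.
Proof. by have := rinnerBl 0 0 x; rewrite !subrr. Qed.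

Lemma rinner_suml I (r : seq I) (F : I -> H) y :
  rinner (\sum_(i <- r) F i) y = \sum_(i <- r) rinner (F i) y.
Proof. by elim/big_rec2: _ => [|i _ z _ <-]; rewrite ?rinner0l ?rinnerDl. Qed.

Lemma rinner_sumr I (r : seq I) (F : I -> H) y :
  rinner y (\sum_(i <- r) F i) = \sum_(i <- r) rinner y (F i).
Proof. by rewrite rinnerC rinner_suml; apply: eq_bigr => i _; rewrite rinnerC. Qed.

Lemma normE x : `|x| = (rnorm x)%:C.
Proof. by rewrite /rnorm RRe_real// normr_real. Qed.

Lemma rnorm_ge0 x : 0 <= rnorm x.
Proof. by rewrite -lecR -normE normr_ge0. Qed.

Lemma rinner_diag x : rinner x x = rnorm x ^+ 2.
Proof. by rewrite /rinner -sqr_norm_inner normE -rmorphXn. Qed.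

Lemma rinner_ge0 x : 0 <= rinner x x.
Proof. by rewrite rinner_diag sqr_ge0. Qed.

Lemma rinner_CS x y : rinner x y ^+ 2 <= rinner x x * rinner y y.
Proof.
apply: quadratic_ge0_disc => [|t]; first exact: rinner_ge0.
have := rinner_ge0 (x + t%:C *: y).
by rewrite !(rinnerDl, rinnerDr, rinnerZl, rinnerZr) (rinnerC y x); lra.
Qed.

Lemma rinner_le x y : rinner x y <= rnorm x * rnorm y.
Proof.
apply: (le_trans (ler_norm _)); rewrite -ler_sqr ?nnegrE ?mulr_ge0 ?rnorm_ge0//.
by rewrite real_normK ?num_real// exprMn -!rinner_diag rinner_CS.
Qed.

Lemma rnormD x y : rnorm (x + y) <= rnorm x + rnorm y.
Proof. by rewrite -lecR rmorphD/= -!normE ler_normD. Qed.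

Lemma rnormN x : rnorm (- x) = rnorm x.
Proof. by rewrite /rnorm normrN. Qed.

Lemma rnormZ (a : R) x : rnorm (a%:C *: x) = `|a| * rnorm x.
Proof.
apply: complexI; rewrite rmorphM/= -!normE normrZ normc_def/= expr0n addr0.
by rewrite sqrtr_sqr.
Qed.

Lemma rnorm0 : rnorm (0 : H) = 0.
Proof. by rewrite /rnorm normr0. Qed.

Lemma rnorm_eq0 x : rnorm x = 0 -> x = 0.
Proof. by move=> x0; apply/normr0_eq0; rewrite normE x0. Qed.

Lemma is_adjoint_rinner (T T' : H -> H) x y :
  is_adjoint T T' -> rinner (T x) y = rinner x (T' y).
Proof. by move=> adj; rewrite /rinner adj. Qed.

Section Unitary.
Variable U : unitary H.

Lemma unitaryB x y : U (x - y) = U x - U y.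
Proof. exact: linearB. Qed.

Lemma unitaryD x y : U (x + y) = U x + U y.
Proof. exact: linearD. Qed.

Lemma unitaryZ a x : U (a *: x) = a *: U x.
Proof. exact: linearZ. Qed.

Lemma unitary_rinnerV x y : rinner (U x) y = rinner x ((U^-1)%g y).
Proof. by apply: is_adjoint_rinner; have [] := unitary_adjP U. Qed.

Lemma unitaryK x : (U^-1)%g (U x) = x.
Proof. by have [_ UK _] := unitary_adjP U; exact: UK. Qed.

Lemma unitary_rinner x y : rinner (U x) (U y) = rinner x y.
Proof. by rewrite unitary_rinnerV unitaryK. Qed.

Lemma unitary_rnorm x : rnorm (U x) = rnorm x.
Proof.
by apply/eqP; rewrite -(@eqrXn2 _ 2) ?rnorm_ge0// -!rinner_diag unitary_rinner.
Qed.

End Unitary.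
End RealInnerProduct.

(** * Functions of positive type and translations *)

Section PositiveDefinite.
Context {R : realType} {G : groupType}.
Implicit Types (u : G -> R) (g h x y : G).

Definition gkernel u x y : R := u (x^-1 * y)%g.

Definition posdef u : Prop := (forall g, u (g^-1)%g = u g) /\ psd (gkernel u).

Lemma kform_gkernelB u d (l : seq (R * G)) :
  kform (gkernel (fun g => u g - d)) l l =
  kform (gkernel u) l l - d * lincomb (fun=> 1) l ^+ 2.
Proof.
have E x : lincomb (gkernel (fun g => u g - d) x) l =
    lincomb (gkernel u x) l - d * lincomb (fun=> 1) l.
  by rewrite -lincomb_const -lincombB.
rewrite /kform (eq_lincomb l E) lincombB lincomb_const; ring.
Qed.

Section GNS.
Variables (u : G -> R) (pu : posdef u).

Lemma gkernelC x y : gkernel u x y = gkernel u y x.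
Proof. by rewrite /gkernel -pu.1 invgM invgK. Qed.

Definition gns_kernel : pdkernel R G := PDKernel gkernelC pu.2.

Local Notation k := gns_kernel.
Local Notation V := (rkhs_realHilbert k).
Local Notation K := (complexification V).

Definition lshift g (l : seq (R * G)) : seq (R * G) :=
  [seq (p.1, (g * p.2)%g) | p <- l].

Lemma lincomb_lshift g f (l : seq (R * G)) :
  lincomb f (lshift g l) = lincomb (fun x => f (g * x)%g) l.
Proof. exact: big_map. Qed.

Lemma kform_lshift g l : kform k (lshift g l) (lshift g l) = kform k l l.
Proof.
rewrite /kform lincomb_lshift; apply: eq_lincomb => x; rewrite lincomb_lshift.
by apply: eq_lincomb => y; rewrite /= /gkernel invgM -mulgA mulKg.
Qed.

(** The form is invariant under left translation of combinations, so translating [f] merely permutes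
    the test combinations in the supremum. *)
Lemma gns_shift_bound g f l : rkhs_bounded k f ->
  2 * lincomb (fun x => f (g^-1 * x)%g) l - kform k l l <= rkhs_sqnorm k f.
Proof.
move=> bf; have := rkhs_sqnorm_ub (lshift (g^-1)%g l) bf.
by rewrite kform_lshift lincomb_lshift.
Qed.

Lemma gns_shift_subproof g (f : rkhs k) :
  (fun x => f (g^-1 * x)%g) \in rkhs_pred k.
Proof.
apply/rkhs_predP; exists (rkhs_sqnorm k f) => l.
exact/gns_shift_bound/rkhsP.
Qed.

Definition gns_shift g (f : rkhs k) : rkhs k := RKHS (gns_shift_subproof g f).

Lemma gns_shiftM g h f : gns_shift (g * h)%g f = gns_shift g (gns_shift h f).
Proof. by apply: rkhs_ext => x /=; rewrite invgM mulgA. Qed.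

Lemma gns_shift1 f : gns_shift 1%g f = f.
Proof. by apply: rkhs_ext => x /=; rewrite invg1 mul1g. Qed.

Lemma gns_shift_norm g f : rkhs_norm2 (gns_shift g f) = rkhs_norm2 f.
Proof.
have le h f' : rkhs_norm2 (gns_shift h f') <= rkhs_norm2 f'.
  by apply: rkhs_sqnorm_le => l; exact/gns_shift_bound/rkhsP.
apply/eqP; rewrite eq_le le -{1}(gns_shift1 f) -(mulVg g) gns_shiftM.
exact: le.
Qed.

Lemma gns_shift_form g f f' :
  rkhs_form (gns_shift g f) f' = rkhs_form f (gns_shift (g^-1)%g f').
Proof.
rewrite -{1}(gns_shift1 f') -(mulgV g) gns_shiftM /rkhs_form /polar.
set h := gns_shift _ f'.
have -> : gns_shift g f + gns_shift g h = gns_shift g (f + h).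
  exact: rkhs_ext.
have -> : gns_shift g f - gns_shift g h = gns_shift g (f - h).
  exact: rkhs_ext.
by rewrite !gns_shift_norm.
Qed.

Definition gns_op g (v : K) : K := (gns_shift g v.1, gns_shift g v.2).

Lemma gns_opM g h v : gns_op (g * h)%g v = gns_op g (gns_op h v).
Proof. by rewrite /gns_op !gns_shiftM. Qed.

Lemma gns_op1 v : gns_op 1%g v = v.
Proof. by case: v => a b; rewrite /gns_op !gns_shift1. Qed.

Lemma gns_op_unitary g : Defs.is_unitary (gns_op g).
Proof.
split.
  move=> z [a b] [c d]; rewrite /gns_op; congr pair; exact: rkhs_ext.
exists (gns_op (g^-1)%g); split.
- move=> [a b] [c d]; rewrite /inner/= /cpx_inner/=.
  by rewrite !gns_shift_form.
- by move=> v; rewrite -gns_opM mulVg gns_op1.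
- by move=> v; rewrite -gns_opM mulgV gns_op1.
Qed.

Definition gns_rep g : unitary K := Unitary (gns_op_unitary g).

Lemma gns_repM : {morph gns_rep : g h / (g * h)%g}.
Proof. by move=> g h; apply: unitary_eq => v; exact: gns_opM. Qed.

HB.instance Definition _ := isMultiplicative.Build G (unitary K) gns_rep gns_repM.

Definition gns_vec : K := (rkhs_kernel k 1%g, 0).

Lemma gns_coef g : rinner (gns_rep g gns_vec) gns_vec = u g.
Proof.
have -> : rinner (gns_rep g gns_vec) gns_vec =
    rkhs_form (gns_shift g (rkhs_kernel k 1%g)) (rkhs_kernel k 1%g) +
    rkhs_form (gns_shift g 0) (0 : rkhs k) by [].
rewrite rkhs_form_kernel rkhs_formC /rkhs_form polar0; first last.
- by move=> t f; exact: rkhs_sqnormZ (rkhsP f).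
by rewrite addr0 /= /gkernel invg1 mul1g mulg1 pu.1.
Qed.

(** Applied to all multiples of [l], a bound [M] on the norm of the constant gives (c s)^2 <= M
    q(l), with s the total weight of [l] and q the kernel form. Then [c ^+ 2 / (M + 1)] could still
    be subtracted from [u], against maximality; the 1 keeps the denominator positive. *)
Lemma gns_constant c : (forall c, 0 < c -> ~ posdef (fun g => u g - c)) ->
  rkhs_bounded k (fun=> c) -> c = 0.
Proof.
move=> umax [M cM]; apply: contrapT => /eqP c0.
have M0 : 0 <= M.
  by have := cM [::]; rewrite /kform /lincomb !big_nil mulr0 subr0.
have d0 : 0 < c ^+ 2 / (M + 1).
  by rewrite divr_gt0 ?ltr_wpDl// exprn_even_gt0.
apply: (umax _ d0); split=> [g|l]; first by rewrite pu.1.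
set d := c ^+ 2 / _; set s := lincomb (fun=> 1) l.
rewrite kform_gkernelB -/s.
have /(_ (pdk_psd k l)) := @quadratic_ge0_disc _ M (- (c * s)) (kform k l l).
rewrite sqrrN subr_ge0 => csM.
rewrite /d mulrAC ler_pdivrMr ?ltr_wpDl// -exprMn.
apply: le_trans (_ : M * kform k l l <= _); last first.
  by rewrite mulrC ler_wpM2l ?pdk_psd// lerDl.
apply: csM => t; have := cM (lscale t l).
by rewrite lincomb_scale kform_scalel kform_scaler lincomb_const -/s; lra.
Qed.

(* Invariant vectors are pairs of constant functions, and a nonzero constant
   function has finite norm only if [u - c] is positive definite for some [c > 0]. *)
Lemma gns_no_invariant :
  (forall c, 0 < c -> ~ posdef (fun g => u g - c)) ->
  no_invariant_vectors (gns_rep : {multiplicative G -> unitary K}).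
Proof.
move=> umax [a b] inv.
have z (f : rkhs k) : (forall g, gns_shift g f = f) -> f = 0.
  move=> fi; have fc x : f x = f 1%g.
    by rewrite -[in LHS](fi x) /= mulVg.
  have /gns_constant f0 : rkhs_bounded k (fun=> f 1%g).
    by have := rkhsP f; congr (rkhs_bounded k _); apply/funext.
  by apply: rkhs_ext => x; rewrite fc f0.
rewrite (z a); last by move=> g; have /(congr1 fst) := inv g.
by rewrite (z b) //; move=> g; have /(congr1 snd) := inv g.
Qed.

End GNS.

End PositiveDefinite.

(** * The spectral gap *)

Section KazhdanGap.
Context {R : realType} {G : groupType}.
Implicit Types (u phi : G -> R) (g h : G) (S : {fset G}).

Lemma posdef_ge0 u : posdef u -> 0 <= u 1%g.
Proof.
move=> [_ /(_ [:: (1, 1%g)])].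
by rewrite /kform /lincomb !big_seq1/= /gkernel invg1 mulg1 !mul1r.
Qed.

(* Splitting off the invariant part of the GNS representation of [u]. *)
Lemma posdef_max_constant u : posdef u ->
  exists c, [/\ 0 <= c, posdef (fun g => u g - c) &
    forall d, 0 < d -> ~ posdef (fun g => u g - c - d)].
Proof.
move=> pu; pose A := [set c | posdef (fun g => u g - c)].
have A0 : A 0.
  by rewrite /A/= (_ : (fun _ => _) = u)//; apply/funext => g; rewrite subr0.
have ubA : has_ubound A.
  by exists (u 1%g) => c /posdef_ge0; rewrite subr_ge0.
(* For each combination, admissibility of [c] is the closed condition c s^2 <= q(l), so the supremum
   is attained. *)
have Asup : A (sup A).
  split=> [g|l]; first by rewrite pu.1.
  rewrite kform_gkernelB subr_ge0; set s := lincomb _ _.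
  have [s0|s0] := eqVneq (s ^+ 2) 0; first by rewrite s0 mulr0 pu.2.
  have s2 : 0 < s ^+ 2 by rewrite lt_neqAle eq_sym s0 sqr_ge0.
  rewrite -ler_pdivlMr//; apply: ge_sup; first by exists 0.
  by move=> c [_ /(_ l)]; rewrite kform_gkernelB subr_ge0 ler_pdivlMr.
exists (sup A); split=> // [|d d0 pd]; first exact: ub_le_sup.
have : A (sup A + d).
  by rewrite /A/= (_ : (fun _ => _) = (fun g => u g - sup A - d))//;
     apply/funext => g; rewrite opprD addrA.
by move=> /(ub_le_sup ubA); rewrite gerDl leNgt d0.
Qed.

Lemma posdef_split u : posdef u ->
  exists c, [/\ 0 <= c, posdef (fun g => u g - c) &
  exists (K : hilbertType R) (rho : {multiplicative G -> unitary K}) (eta : K),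
    no_invariant_vectors rho /\ forall g, rinner (rho g eta) eta = u g - c].
Proof.
move=> /posdef_max_constant[c [c0 pc cmax]]; exists c; split=> //.
exists (complexification (rkhs_realHilbert (gns_kernel pc))).
exists (gns_rep pc); exists (gns_vec pc); split.
  exact: gns_no_invariant.
exact: gns_coef.
Qed.

Section Representation.
Context {K : hilbertType R} (rho : {multiplicative G -> unitary K}).

Lemma rep_one : rho 1%g = 1%g.
Proof. by apply: (mulgI (rho 1%g)); rewrite -gmulfM !mulg1. Qed.

Lemma rep1 x : rho 1%g x = x.
Proof. by rewrite rep_one. Qed.

Lemma repV g : rho (g^-1)%g = ((rho g)^-1)%g.
Proof. by apply/esym/mulg1_eq; rewrite -gmulfM mulgV rep_one. Qed.

Lemma repM g h x : rho (g * h)%g x = rho g (rho h x).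
Proof. by rewrite gmulfM. Qed.

Lemma rep_displacement g x :
  rnorm (rho g x - x) ^+ 2 = 2 * (rnorm x ^+ 2 - rinner (rho g x) x).
Proof.
rewrite -!rinner_diag rinnerBl !rinnerBr unitary_rinner (rinnerC x); ring.
Qed.

Lemma rep_displacementV g x : rnorm (rho (g^-1)%g x - x) = rnorm (rho g x - x).
Proof.
by rewrite -(unitary_rnorm (rho g)) unitaryB -repM mulgV rep1 -rnormN opprB.
Qed.

Lemma kazhdan_displacement S kappa x : kazhdan_constant S kappa ->
  no_invariant_vectors rho -> x != 0 ->
  exists2 s, s \in S & kappa * rnorm x <= rnorm (rho s x - x).
Proof.
move=> [k0 kS] ninv x0; apply: bigmax_ge_ex (kS _ _ ninv x).
rewrite mulr_gt0// lt_neqAle rnorm_ge0 andbT eq_sym.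
by apply: contra x0 => /eqP/rnorm_eq0/eqP.
Qed.

End Representation.

(* When a single involution s carries all the displacement of x, the vector
   (1 - b) x + b (s x) is still almost fixed by S minus s, while s moves it by
   strictly less; since kappa < 2 this violates the Kazhdan inequality. *)
Lemma kazhdan_strict S kappa : symmetric_fset S -> kazhdan_constant S kappa ->
  kappa < 2 -> exists2 d : R, 0 < d &
  forall (K : hilbertType R) (rho : {multiplicative G -> unitary K}),
    no_invariant_vectors rho -> forall x,
    (kappa ^+ 2 + d) * rnorm x ^+ 2 <= \sum_(s <- S) rnorm (rho s x - x) ^+ 2.
Proof.
move=> symS kS k2; have k0 : 0 < kappa := kS.1.
(* Solves [kappa * th = kappa / 2 + 2 * (1 - th)]. The left side times [n] is below [kappa] times
   the norm of [y]; the right side times [n] exceeds the displacement of [y] by any [t] other than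
   [s]. *)
pose th := (4 + kappa) / (2 * (2 + kappa)).
(* Equal to th^2 + kappa^2 (1 - th^2) / 4. If [s] carries the displacement of [y] as well, then
   kappa^2 n^2 <= w k^2, an improvement because [kappa < 2] makes [w < 1]. *)
pose w := 1 - (1 - th ^+ 2) * (1 - kappa ^+ 2 / 4).
(* The first bound leaves at most [kappa / 2 * n] for the displacement of [x] by any other
   generator; the second gives (kappa^2 + d) w <= kappa^2. *)
pose d := Num.min (kappa ^+ 2 / 4) (kappa ^+ 2 * (1 - w)).
have th01 : 0 < th < 1.
  rewrite divr_gt0 ?addr_gt0 ?mulr_gt0 ?addr_gt0//= ltr_pdivrMr ?mulr_gt0 ?addr_gt0//.
  lra.
exists d.
  rewrite lt_min; apply/andP; split; first by rewrite divr_gt0 ?exprn_gt0.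
  rewrite mulr_gt0 ?exprn_gt0// /w opprB addrC subrK mulr_gt0//.
    by rewrite subr_gt0 expr_lt1//; case/andP: th01 => // /ltW.
  by rewrite subr_gt0 ltr_pdivrMr// mul1r; nra.
move=> K rho ninv x.
have [->|x0] := eqVneq x 0.
  by rewrite rnorm0 expr0n mulr0 sumr_ge0// => s _; rewrite sqr_ge0.
set D := \sum_(s <- _) _; set n := rnorm x.
have n0 : 0 < n.
  rewrite lt_neqAle rnorm_ge0 andbT eq_sym.
  by apply: contra x0 => /eqP/rnorm_eq0/eqP.
have [s sS] := kazhdan_displacement kS ninv x0.
set k := rnorm (rho s x - x) => kn.
have d1 : d <= kappa ^+ 2 / 4 by rewrite ge_min lexx.
have d2 : d <= kappa ^+ 2 * (1 - w) by rewrite ge_min lexx orbT.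
have kn2 : kappa ^+ 2 * n ^+ 2 <= k ^+ 2.
  by rewrite -exprMn ler_sqr ?nnegrE ?mulr_ge0 ?rnorm_ge0 ?(ltW k0).
have sumS t : t \in S -> s != t -> k ^+ 2 + rnorm (rho t x - x) ^+ 2 <= D.
  move=> tS st; apply: (@sum_ge2 _ _ _ (fun s => rnorm (rho s x - x) ^+ 2)) => //.
    exact: fset_uniq.
  by move=> i; rewrite sqr_ge0.
(* When [s] differs from its inverse, both lie in [S] and contribute equally, so the sum is already
   at least 2 kappa^2 n^2. *)
have [sV|sV] := eqVneq s (s^-1)%g; last first.
  have := sumS _ (symS _ sS) sV; rewrite rep_displacementV -/k.
  have : 0 <= n ^+ 2 by rewrite sqr_ge0.
  nra.
rewrite leNgt; apply/negP => Dlt.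
have thE : kappa * th = kappa / 2 + 2 * (1 - th).
  by rewrite /th; field; rewrite gt_eqF// addr_gt0.
have [th0 th1] := andP th01.
(* If m is the [s]-fixed midpoint of [x] and [rho s x], then y = m - (th / 2) v, so [s] moves [y] by
   exactly [th * k]. *)
pose b := (1 - th) / 2; pose v := rho s x - x; pose y := x + b%:C *: v.
have ss z : rho s (rho s z) = z by rewrite -repM {2}sV mulgV rep1.
have kE : k ^+ 2 = 2 * (n ^+ 2 - rinner (rho s x) x) by exact: rep_displacement.
have y2 : rnorm y ^+ 2 = n ^+ 2 - (1 - th ^+ 2) * k ^+ 2 / 4.
  rewrite -rinner_diag /y /v !(rinnerDl, rinnerDr, rinnerZl, rinnerZr,
    rinnerNl, rinnerNr).
  by rewrite unitary_rinner (rinnerC x (rho s x)) kE /n -rinner_diag /b; field.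
have k4 : k ^+ 2 <= 4 * n ^+ 2.
  have := rinner_le (- rho s x) x; rewrite rnormN unitary_rnorm rinnerNl kE -/n.
  lra.
have y2ge : th ^+ 2 * n ^+ 2 <= rnorm y ^+ 2.
  rewrite y2; have : 0 <= 1 - th ^+ 2 by nra.
  nra.
have yge : th * n <= rnorm y.
  by apply: le_of_sqr (rnorm_ge0 y) _; rewrite exprMn.
have y0 : y != 0.
  by apply: contraTneq yge => ->; rewrite rnorm0 -ltNge mulr_gt0.
have [t tS tk] := kazhdan_displacement kS ninv y0.
have [ts|st] := eqVneq s t.
  move: tk; rewrite -{t tS}ts.
  have -> : rho s y - y = th%:C *: v.
    have sv : rho s v = - v by rewrite unitaryB ss opprB.
    rewrite unitaryD unitaryZ sv scalerN opprD addrACA -/v -opprD -scalerDl.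
    have -> : th%:C = 1 - (b%:C + b%:C) :> R[i].
      rewrite -rmorphD -(rmorph1 (real_complex R)) -rmorphB; congr _%:C.
      by rewrite /b; field.
    by rewrite scalerBl scale1r.
  rewrite rnormZ gtr0_norm// -/k => tk.
  have : kappa ^+ 2 * rnorm y ^+ 2 <= th ^+ 2 * k ^+ 2.
    by rewrite -!exprMn ler_sqr// nnegrE mulr_ge0 ?rnorm_ge0 ?ltW.
  rewrite y2 => h.
  have : k ^+ 2 < (kappa ^+ 2 + d) * n ^+ 2.
    apply: le_lt_trans Dlt; rewrite /D (big_rem s)//= lerDl.
    by rewrite sumr_ge0// => i _; rewrite sqr_ge0.
  have hw : kappa ^+ 2 * n ^+ 2 <= k ^+ 2 * w by rewrite /w; lra.
  have kn0 : 0 < kappa ^+ 2 * n ^+ 2 by rewrite mulr_gt0 ?exprn_gt0.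
  have w0 : 0 < w.
    rewrite ltNge; apply/negP => w0; have : 0 <= k ^+ 2 by rewrite sqr_ge0.
    nra.
  have : (kappa ^+ 2 + d) * w <= kappa ^+ 2.
    apply: le_trans (_ : (kappa ^+ 2 + kappa ^+ 2 * (1 - w)) * w <= _).
      by rewrite ler_wpM2r ?(ltW w0)// lerD2l.
    have : 0 <= kappa ^+ 2 * (1 - w) ^+ 2 by rewrite mulr_ge0 ?sqr_ge0.
    lra.
  rewrite -(ler_pM2r (_ : 0 < n ^+ 2)) ?exprn_gt0// => h1 h2.
  have : k ^+ 2 * w < (kappa ^+ 2 + d) * n ^+ 2 * w by rewrite ltr_pM2r.
  lra.
have tx : rnorm (rho t x - x) < kappa / 2 * n.
  have := sumS _ tS st => h.
  apply: lt_of_sqr; first by rewrite !mulr_ge0// ltW.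
  have : 0 < n ^+ 2 by rewrite exprn_gt0.
  nra.
have : rnorm (rho t y - y) <= rnorm (rho t x - x) + (1 - th) * k.
  have -> : rho t y - y = (rho t x - x) + b%:C *: (rho t v - v).
    by rewrite unitaryD unitaryZ opprD addrACA -scalerBr.
  apply: le_trans (rnormD _ _) _; rewrite lerD2l rnormZ ger0_norm; last first.
    by rewrite /b divr_ge0// subr_ge0 ltW.
  have : rnorm (rho t v - v) <= k + k.
    by apply: le_trans (rnormD _ _) _; rewrite rnormN unitary_rnorm.
  rewrite -(ler_pM2l (_ : 0 < b)); last by rewrite /b divr_gt0// subr_gt0.
  by move=> h; apply: le_trans h _; rewrite /b; lra.
have k2n : k <= 2 * n.
  by apply: le_of_sqr; [rewrite mulr_ge0// ltW|lra].
nra.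
Qed.

End KazhdanGap.

(** * The gap inequality for functions of positive type *)

Section Laplacian2.
Context {R : realType} {G : groupType}.
Implicit Types (u phi : G -> R) (g h : G) (S : {fset G}).

(* If [phi g = <rho g x, x>], these are [n <Delta x, x>] and
   [n ^ 2 <Delta ^ 2 x, x>] with [n = #|S|]. *)
Definition lap1 S phi : R := \sum_(s <- S) (phi 1%g - phi s).

Definition lap2 S phi : R :=
  \sum_(r <- S) \sum_(s <- S) (phi 1%g - phi r - phi s + phi (r^-1 * s)%g).

(** With [lap2B]: constants cancel, so splitting off the invariant part of a function changes
    neither side of the gap inequality. *)
Lemma lap1B S phi c : lap1 S (fun g => phi g - c) = lap1 S phi.
Proof. by apply: eq_bigr => s _; rewrite opprB addrA subrK. Qed.

Lemma lap2B S phi c : lap2 S (fun g => phi g - c) = lap2 S phi.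
Proof. by apply: eq_bigr => r _; apply: eq_bigr => s _; ring. Qed.

(** The gap at the single vector [x] is enough, without spectral theory: it says nu |x|^2 <= <v, x>,
    and Cauchy-Schwarz <v, x>^2 <= |v|^2 |x|^2 turns this into nu <v, x> <= |v|^2. *)
Lemma rep_lap_ge S (K : hilbertType R) (rho : {multiplicative G -> unitary K})
    (x : K) (nu : R) (phi := fun g => rinner (rho g x) x) : 0 < nu ->
  2 * nu * rnorm x ^+ 2 <= \sum_(s <- S) rnorm (rho s x - x) ^+ 2 ->
  nu * lap1 S phi <= lap2 S phi.
Proof.
move=> nu0 gap; pose v := \sum_(s <- S) (x - rho s x).
have p1 : phi 1%g = rnorm x ^+ 2 by rewrite /phi rep1 rinner_diag.
have v1 : rinner v x = lap1 S phi.
  by rewrite rinner_suml; apply: eq_bigr => s _; rewrite rinnerBl p1 rinner_diag.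
have v2 : rinner v v = lap2 S phi.
  rewrite rinner_suml; apply: eq_bigr => r _; rewrite rinner_sumr.
  apply: eq_bigr => s _; rewrite rinnerBl !rinnerBr rinner_diag p1.
  have -> : phi (r^-1 * s)%g = rinner (rho r x) (rho s x).
    by rewrite /phi repM repV rinnerC; exact/esym/unitary_rinnerV.
  by rewrite (rinnerC x) -/(phi s) -/(phi r); ring.
have gap1 : nu * rnorm x ^+ 2 <= lap1 S phi.
  rewrite -(ler_pM2l (_ : 0 < 2 :> R))// mulrA; apply: le_trans gap _.
  rewrite mulr_sumr; apply: ler_sum => s _.
  by rewrite rep_displacement p1.
have := rinner_CS v x; rewrite v1 v2 rinner_diag => cs.
have l2 : 0 <= lap2 S phi by rewrite -v2 rinner_ge0.
have n2 : 0 <= rnorm x ^+ 2 by rewrite sqr_ge0.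
have [->|l10] := eqVneq (lap1 S phi) 0; first by rewrite mulr0.
have l1 : 0 < lap1 S phi.
  by rewrite lt_neqAle eq_sym l10 (le_trans _ gap1)// mulr_ge0// ltW.
rewrite -(ler_pM2r l1) -mulrA -expr2.
apply: le_trans (_ : nu * (lap2 S phi * rnorm x ^+ 2) <= _).
  by rewrite ler_pM2l.
by rewrite mulrCA ler_wpM2l.
Qed.

Lemma kazhdan_gap S kappa : symmetric_fset S -> @kazhdan_constant G R S kappa ->
  kappa < 2 -> exists2 nu, kappa ^+ 2 / 2 < nu &
  forall u, posdef u -> nu * lap1 S u <= lap2 S u.
Proof.
move=> symS kS k2; have k0 := kS.1.
have [d d0 strict] := kazhdan_strict symS kS k2.
exists ((kappa ^+ 2 + d) / 2); first by rewrite ltr_pM2r ?invr_gt0// ltrDl.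
move=> u /posdef_split[c [_ _ [K [rho [eta [ninv uE]]]]]].
have nu0 : 0 < (kappa ^+ 2 + d) / 2 by rewrite divr_gt0// addr_gt0// exprn_gt0.
have := @rep_lap_ge S K rho eta _ nu0.
rewrite [2 * _]mulrC divfK ?pnatr_eq0//.
move=> /(_ (strict _ _ ninv eta)) /=.
rewrite (_ : (fun g => _) = (fun g => u g - c)); last exact/funext.
by rewrite lap1B lap2B.
Qed.

(** This is the coefficient of the regular representation at the point mass at 1; its form is the
    sum over distinct points of the squared total weight, which is why the list is freed of
    duplicates. *)
Lemma posdef_delta : posdef (fun g : G => (g == 1%g)%:R : R).
Proof.
split=> [g|l]; first by rewrite invg_eq1.
pose Z := undup [seq p.2 | p <- l].
have kE x y : gkernel (fun g : G => (g == 1%g)%:R : R) x y = (x == y)%:R.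
  by rewrite /gkernel mulg_eq1 eqg_inv.
rewrite /kform.
have E x : x \in Z -> forall y,
    (x == y)%:R = \sum_(z <- Z) (x == z)%:R * (y == z)%:R :> R.
  move=> xZ y; rewrite (bigD1_seq x) ?undup_uniq//= eqxx mul1r eq_sym.
  by rewrite big1 ?addr0// => z; rewrite eq_sym => /negPf->; rewrite mul0r.
have -> : lincomb (fun x => lincomb (gkernel (fun g : G => (g == 1%g)%:R) x) l) l =
    \sum_(z <- Z) lincomb (fun x => (x == z)%:R) l ^+ 2.
  rewrite /lincomb; under [RHS]eq_bigr do rewrite expr2 mulr_suml.
  rewrite exchange_big /= big_seq [RHS]big_seq; apply: eq_bigr => p pl.
  under [RHS]eq_bigr do rewrite mulr_sumr.
  rewrite exchange_big mulr_sumr; apply: eq_bigr => r _.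
  rewrite kE (E p.2) ?mem_undup ?map_f// mulr_sumr mulr_sumr.
  by apply: eq_bigr => z _; ring.
by rewrite sumr_ge0// => z _; rewrite sqr_ge0.
Qed.

(** Split the constant [c] off the point mass at 1. Testing on n distinct points gives c <= 1/n. The
    vector [eta] is moved by at most sqrt 2, so c < 1 forces kappa^2 (1 - c) <= 2 and hence c >=
    1/2. Three elements are thus impossible, and in a group of order two [kappa] is exactly 2. There
    the off-diagonal terms of [lap2] vanish identically, whatever [phi] is. *)
Lemma kazhdan_ge2 S kappa : symmetric_fset S -> @kazhdan_constant G R S kappa ->
  2 <= kappa -> forall phi, kappa ^+ 2 / 2 * lap1 S phi = lap2 S phi.
Proof.
move=> symS kS k2.
have [c [c0 pc [K [rho [eta [ninv uE]]]]]] := posdef_split posdef_delta.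
have cub (xs : seq G) : uniq xs -> c * (size xs)%:R ^+ 2 <= (size xs)%:R.
  move=> uxs; have := pc.2 [seq (1, x) | x <- xs].
  rewrite kform_gkernelB subr_ge0.
  have -> : lincomb (fun=> 1) [seq (1, x) | x <- xs] = (size xs)%:R :> R.
    by rewrite /lincomb big_map -sum1_size natr_sum; apply: eq_bigr => x _; rewrite mulr1.
  move=> /le_trans; apply; rewrite /kform /lincomb big_map -sum1_size natr_sum.
  rewrite big_seq [leRHS]big_seq; apply: ler_sum => x xxs.
  rewrite big_map (bigD1_seq x)//= /gkernel mulVg eqxx !mul1r big1 ?addr0// => y.
  by rewrite mulg_eq1 eqg_inv eq_sym => /negPf->; rewrite mulr0.
have n2 : rnorm eta ^+ 2 = 1 - c.
  by rewrite -rinner_diag; have := uE 1%g; rewrite rep1 eqxx.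
have k0 : 0 < kappa := kS.1.
have k4 : 4 <= kappa ^+ 2 by nra.
have cle : c < 1 -> kappa ^+ 2 * (1 - c) <= 2.
  move=> c1; have eta0 : eta != 0.
    apply: contraTneq c1 => eta0; move: n2; rewrite eta0 rnorm0 expr0n/= => /esym/eqP.
    by rewrite subr_eq0 -leNgt => /eqP->.
  have [s sS] := kazhdan_displacement kS ninv eta0.
  move=> h; have : (kappa * rnorm eta) ^+ 2 <= rnorm (rho s eta - eta) ^+ 2.
    by rewrite ler_sqr ?nnegrE ?mulr_ge0 ?rnorm_ge0 ?(ltW k0).
  rewrite exprMn rep_displacement n2 uE; case: eqP => _ /=; nra.
have [triv|/existsNP[a /eqP a1]] := pselect (forall g : G, g = 1%g).
  move=> phi; rewrite /lap1 /lap2 !big1 ?mulr0// => r _; last by rewrite (triv r) subrr.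
  by rewrite big1// => s _; rewrite (triv (_ * _)%g) (triv r) (triv s); ring.
have c2 : c <= 2^-1.
  by have := cub [:: 1%g; a]; rewrite /= inE eq_sym a1 => /(_ isT); lra.
have kE : kappa ^+ 2 = 4.
  by have := cle; rewrite (_ : c < 1); [move=> /(_ isT); nra|lra].
have G2 (x y : G) : x != y -> x = 1%g \/ y = 1%g.
  move=> xy; have [->|x1] := eqVneq x 1%g; first by left.
  have [->|y1] := eqVneq y 1%g; first by right.
  have := cub [:: 1%g; x; y]; rewrite /= !inE negb_or !(eq_sym 1%g) x1 y1 xy.
  move=> /(_ isT) c3; have := cle; rewrite (_ : c < 1); last lra.
  by rewrite kE => /(_ isT) c4; exfalso; lra.
have GV (x : G) : (x^-1)%g = x.
  have [//|/G2[/eqP|->]] := eqVneq (x^-1)%g x; last by rewrite invg1.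
  by rewrite invg_eq1 => /eqP ->; rewrite invg1.
move=> phi; rewrite kE /lap1 /lap2 mulr_sumr big_seq [RHS]big_seq.
apply: eq_bigr => r rS; rewrite (bigD1_seq r) ?fset_uniq//= mulVg big1.
  by field.
move=> s sr; have [r1|s1] := G2 _ _ sr.
  by rewrite r1 mulg1 GV; ring.
by rewrite s1 invg1 mul1g; ring.
Qed.

End Laplacian2.

(** * Functions conditionally of negative type *)

Section SchurProduct.
Context {R : realType} {X : eqType}.
Implicit Types (k : pdkernel R X) (v : X -> R) (l : seq (R * X)).

Lemma pdkernel_CS k x l : lincomb (k x) l ^+ 2 <= k x x * kform k l l.
Proof.
rewrite mulrC; apply: quadratic_ge0_disc => [|t]; last first.
  have := pdk_psd k (l ++ [:: (t, x)]); rewrite kform_rcons; lra.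
by have := pdk_psd k [:: (1, x)]; rewrite /kform /lincomb !big_seq1/= !mul1r.
Qed.

Lemma kform_rank1 v l : kform (fun x y => v x * v y) l l = lincomb v l ^+ 2.
Proof.
rewrite /kform (eq_lincomb (g := fun x => lincomb v l * v x)).
  by rewrite lincombZ expr2.
by move=> x; rewrite lincombZ mulrC.
Qed.

Lemma kformB (k k' : X -> X -> R) l :
  kform (fun x y => k x y - k' x y) l l = kform k l l - kform k' l l.
Proof.
rewrite /kform -lincombB; apply: eq_lincomb => x; exact: lincombB.
Qed.

Section Cholesky.
Variables (k : pdkernel R X) (x0 : X).

(** The pivot of a Cholesky step; subtracting its square leaves the Schur complement. If the
    diagonal entry is 0, division by zero yields 0, and by Cauchy-Schwarz the row of [x0] vanishes
    already. *)
Let v x := k x0 x / Num.sqrt (k x0 x0).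
Let k0 : 0 <= k x0 x0.
Proof.
by have := pdk_psd k [:: (1, x0)]; rewrite /kform /lincomb !big_seq1/= !mul1r.
Qed.
Let k' x y := k x y - v x * v y.

Let k'C x y : k' x y = k' y x.
Proof. by rewrite /k' pdkC [v x * _]mulrC. Qed.

Let k'_psd : psd k'.
Proof.
move=> l; rewrite kformB kform_rank1 subr_ge0.
rewrite (eq_lincomb (g := fun x => (Num.sqrt (k x0 x0))^-1 * k x0 x)).
  rewrite lincombZ exprMn exprVn sqr_sqrtr//.
  have [->|kn0] := eqVneq (k x0 x0) 0; first by rewrite invr0 mul0r pdk_psd.
  by rewrite ler_pdivrMl ?pdkernel_CS// lt_neqAle eq_sym kn0.
by move=> x; rewrite mulrC.
Qed.

Definition cholesky_step : pdkernel R X := PDKernel k'C k'_psd.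

Lemma cholesky_step0 y : cholesky_step x0 y = 0.
Proof.
rewrite /= /k' /v; have [k00|kn0] := eqVneq (k x0 x0) 0.
  have := pdkernel_CS k x0 [:: (1, y)]; rewrite k00 mul0r /lincomb big_seq1/= mul1r.
  move=> h; have /eqP -> : k x0 y == 0 by rewrite -sqrf_eq0 eq_le h sqr_ge0.
  by rewrite mul0r mulr0 subr0.
rewrite mulrACA -invfM -expr2 sqr_sqrtr// mulrAC divff// mul1r subrr//.
Qed.

Lemma cholesky_stepE : exists v, forall x y, k x y = v x * v y + cholesky_step x y.
Proof. by exists v => x y; rewrite /= /k' addrC subrK. Qed.

End Cholesky.

Lemma pdkernel_decomposition (s : seq X) k : exists vs : seq (X -> R),
  {in s &, forall x y, k x y = \sum_(v <- vs) v x * v y}.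
Proof.
elim: s k => [|x0 s IHs] k; first by exists [::].
have [vs vsE] := IHs (cholesky_step k x0).
have [v vE] := cholesky_stepE k x0.
(* The induction hypothesis says nothing about values at [x0]; setting them to 0 is right because
   the residual kernel vanishes on the row of [x0]. *)
exists (v :: [seq (fun x => if x == x0 then 0 else w x) | w <- vs]) => x y.
rewrite big_cons big_map vE => xs ys; congr (_ + _).
have [xx0|xx0] := eqVneq x x0.
  by rewrite xx0 cholesky_step0 big1// => w _; rewrite mul0r.
have [yx0|yx0] := eqVneq y x0.
  by rewrite yx0 pdkC cholesky_step0 big1// => w _; rewrite mulr0.
by rewrite vsE//; [move: xs|move: ys]; rewrite inE ?(negPf xx0) ?(negPf yx0).
Qed.

Definition lweight v l : seq (R * X) := [seq (p.1 * v p.2, p.2) | p <- l].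

Lemma kform_lweight v (k : X -> X -> R) l :
  kform (fun x y => v x * v y * k x y) l l = kform k (lweight v l) (lweight v l).
Proof.
rewrite /kform [RHS]/lincomb big_map; apply: eq_bigr => p _.
rewrite -mulrA; congr (_ * _); rewrite [in RHS]/lincomb big_map mulr_sumr.
by apply: eq_bigr => r _ /=; ring.
Qed.

(** Only the finitely many points of [l] matter, and on them [k] is a sum of squares of functions;
    multiplying [k'] by one such square just reweights the combination. *)
Lemma schur_product k k' : psd (fun x y => k x y * k' x y).
Proof.
move=> l; have [vs vsE] := pdkernel_decomposition [seq p.2 | p <- l] k.
rewrite (_ : kform _ l l = \sum_(v <- vs) kform (fun x y => v x * v y * k' x y) l l).
  by rewrite sumr_ge0// => v _; rewrite kform_lweight pdk_psd.
rewrite /kform /lincomb exchange_big/= big_seq [RHS]big_seq.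
apply: eq_bigr => p pl; rewrite -mulr_sumr exchange_big/=; congr (_ * _).
rewrite big_seq [RHS]big_seq; apply: eq_bigr => r rl.
by rewrite -mulr_sumr -mulr_suml -vsE// map_f.
Qed.

Lemma pdkernel_pow_psd k n : psd (fun x y => k x y ^+ n).
Proof.
elim: n => [|n IHn].
  move=> l; rewrite (_ : (fun _ => _) = (fun _ _ => 1 * 1)).
    by rewrite (kform_rank1 (fun=> 1)) sqr_ge0.
  by apply/funext => x; apply/funext => y; rewrite mulr1 expr0.
have C x y : k x y ^+ n = k y x ^+ n by rewrite pdkC.
rewrite (_ : (fun _ => _) = (fun x y => k x y * k x y ^+ n)).
  exact: (@schur_product k (PDKernel C IHn)).
by apply/funext => x; apply/funext => y; rewrite exprS.
Qed.

(** The exponential series has nonnegative coefficients, and nonnegativity of each form passes to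
    pointwise limits. *)
Lemma pdkernel_exp k t : 0 <= t -> psd (fun x y => expR (t * k x y)).
Proof.
move=> t0 l.
pose e n x y := \sum_(0 <= i < n) t ^+ i / i`!%:R * k x y ^+ i.
have ecvg x y : e n x y @[n --> \oo] --> expR (t * k x y).
  have := @is_cvg_series_exp_coeff R (t * k x y).
  rewrite (_ : (fun n => e n x y) = series (exp_coeff (t * k x y))) => [|].
    exact.
  apply/funext => n; apply: eq_bigr => i _.
  by rewrite /exp_coeff /= exprMn mulrAC.
have ek : kform (e n) l l @[n --> \oo] --> kform (fun x y => expR (t * k x y)) l l.
  by apply: cvg_lincomb => x; apply: cvg_lincomb => y; exact: ecvg.
apply: (cvgr_to_ge ek); apply: nearW => n; elim: n => [|n IHn].
  rewrite (_ : e 0 = (fun _ _ => 0 * 0)).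
    by rewrite (kform_rank1 (fun=> 0)) sqr_ge0.
  by apply/funext => x; apply/funext => y; rewrite /e big_nil mulr0.
have -> : kform (e n.+1) l l = kform (e n) l l +
    t ^+ n / n`!%:R * kform (fun x y => k x y ^+ n) l l.
  rewrite {1}/kform /kform -lincombZ -lincombD; apply: eq_lincomb => x /=.
  rewrite -lincombZ -lincombD; apply: eq_lincomb => y /=.
  by rewrite /e big_nat_recr.
by rewrite addr_ge0// mulr_ge0 ?pdkernel_pow_psd// divr_ge0// exprn_ge0.
Qed.

End SchurProduct.

(** * Schoenberg's theorem and differentiation at 0 *)

Section Schoenberg.
Context {R : realType} {G : groupType} (psi : G -> R).

Definition condneg : Prop :=
  [/\ psi 1%g = 0, forall g, psi (g^-1)%g = psi g &
      forall l, lincomb (fun=> 1) l = 0 -> kform (gkernel psi) l l <= 0].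

Hypothesis cn : condneg.

Let psi1 : psi 1%g = 0. Proof. by case: cn. Qed.
Let psiV g : psi (g^-1)%g = psi g. Proof. by case: cn. Qed.

Lemma condneg_ge0 g : 0 <= psi g.
Proof.
have [_ _ /(_ [:: (1, 1%g); (-1, g)])] := cn.
rewrite /kform /lincomb !big_cons !big_nil /gkernel /=.
rewrite invg1 !mul1g mulg1 mulVg psi1 psiV.
have -> : 1 * 1 + (-1 * 1 + 0) = 0 :> R by ring.
by move=> /(_ erefl); lra.
Qed.

(* The Gram kernel of the cocycle associated with [psi], up to a factor 2. *)
Definition condneg_gram (x y : G) : R := psi x + psi y - psi (x^-1 * y)%g.

Let gramC x y : condneg_gram x y = condneg_gram y x.
Proof. by rewrite /condneg_gram -(psiV (x^-1 * y)%g) invgM invgK [psi y + _]addrC. Qed.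

(** Adding the point 1 with weight [- s] makes the total weight 0; the inequality for the enlarged
    combination is the claim. *)
Let gram_psd : psd condneg_gram.
Proof.
move=> l; set s := lincomb (fun=> 1) l.
have [_ _ /(_ (l ++ [:: (- s, 1%g)]))] := cn.
rewrite lincomb_cat [lincomb _ [:: _]]big_seq1/= mulr1 subrr => /(_ erefl).
rewrite kform_catl !kform_catr.
have -> : kform (gkernel psi) l [:: (- s, 1%g)] = - s * lincomb psi l.
  rewrite -lincombZ; apply: eq_lincomb => x.
  by rewrite /lincomb big_seq1/= /gkernel mulg1 psiV.
have -> : kform (gkernel psi) [:: (- s, 1%g)] l = - s * lincomb psi l.
  rewrite /kform [LHS]/lincomb big_seq1/=; congr (_ * _); apply: eq_lincomb => x.
  by rewrite /gkernel invg1 mul1g.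
have -> : kform (gkernel psi) [:: (- s, 1%g)] [:: (- s, 1%g)] = 0.
  by rewrite /kform /lincomb !big_seq1/= /gkernel mulVg psi1 !mulr0.
have -> : kform condneg_gram l l = 2 * s * lincomb psi l - kform (gkernel psi) l l.
  rewrite kformB; congr (_ - _).
  rewrite /kform [LHS](eq_lincomb (g := (fun x => s * psi x) \+ (fun=> lincomb psi l))).
    by rewrite lincombD lincombZ (lincomb_const (lincomb psi l)) -/s; ring.
  move=> x /=; rewrite [LHS](eq_lincomb (g := (fun=> psi x) \+ psi))//.
  by rewrite lincombD lincomb_const -/s mulrC.
lra.
Qed.

(** Up to the rank one factor exp(- t psi x) exp(- t psi y), the kernel is the exponential of [t]
    times the Gram kernel. *)
Lemma schoenberg t : 0 <= t -> posdef (fun g => expR (- (t * psi g))).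
Proof.
move=> t0; split=> [g|l]; first by rewrite psiV.
rewrite (_ : gkernel _ = (fun x y => expR (- (t * psi x)) * expR (- (t * psi y)) *
    expR (t * PDKernel gramC gram_psd x y))).
  by rewrite kform_lweight pdkernel_exp.
apply/funext => x; apply/funext => y; rewrite -!expRD /gkernel /= /condneg_gram.
by congr expR; ring.
Qed.

(** First order term at t = 0 of the gap inequality for exp(- t psi). The bounds a - a^2 <= 1 -
    exp(- a) <= a for a >= 0 make the remainder explicit, with coefficient [nu * C1 + C2]. *)
Lemma condneg_lap S nu : 0 <= nu ->
  (forall u, posdef u -> nu * lap1 S u <= lap2 S u) ->
  nu * (\sum_(s <- S) psi s) <=
  \sum_(r <- S) \sum_(s <- S) (psi r + psi s - psi (r^-1 * s)%g).
Proof.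
move=> nu0 gap.
have eub g t : 0 <= t -> 1 - expR (- (t * psi g)) <= t * psi g.
  by move=> t0; have := expR_ge1Dx (- (t * psi g)); lra.
have elb g t : 0 <= t -> t * psi g - t ^+ 2 * psi g ^+ 2 <= 1 - expR (- (t * psi g)).
  move=> t0; have := expR_ge1Dx (t * psi g).
  have a0 : 0 <= t * psi g by rewrite mulr_ge0 ?condneg_ge0.
  rewrite -exprMn expRN; set a := t * psi g in a0 *.
  move=> h; have : (expR a)^-1 <= (1 + a)^-1.
    by rewrite lef_pV2 ?posrE ?expR_gt0 ?ltr_wpDr.
  have : (1 + a)^-1 <= 1 - a + a ^+ 2.
    rewrite -[_^-1]mul1r ler_pdivrMr ?ltr_wpDr//.
    have : 0 <= a ^+ 3 by rewrite exprn_ge0.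
    lra.
  lra.
set A := \sum_(s <- S) psi s; set B := \sum_(r <- S) _.
pose C1 := \sum_(s <- S) psi s ^+ 2.
pose C2 := \sum_(r <- S) \sum_(s <- S) psi (r^-1 * s)%g ^+ 2.
have key t : 0 < t -> nu * A <= B + t * (nu * C1 + C2).
  move=> t0; have t0' := ltW t0.
  have := gap _ (schoenberg t0').
  have : t * A - t ^+ 2 * C1 <= lap1 S (fun g => expR (- (t * psi g))).
    rewrite mulr_sumr mulr_sumr -sumrB; apply: ler_sum => s _.
    by rewrite psi1 mulr0 oppr0 expR0; exact: elb.
  have : lap2 S (fun g => expR (- (t * psi g))) <= t * B + t ^+ 2 * C2.
    rewrite !mulr_sumr -big_split; apply: ler_sum => r _.
    rewrite !mulr_sumr -big_split; apply: ler_sum => s _ /=.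
    rewrite psi1 mulr0 oppr0 expR0.
    have := elb (r^-1 * s)%g _ t0'; have := eub r _ t0'; have := eub s _ t0'.
    lra.
  move=> h2 h1 h; rewrite -(ler_pM2l t0).
  have : nu * (t * A - t ^+ 2 * C1) <= nu * lap1 S (fun g => expR (- (t * psi g))).
    by rewrite ler_wpM2l.
  lra.
have D0 : 0 <= nu * C1 + C2.
  rewrite addr_ge0 ?mulr_ge0// ?sumr_ge0// => r _; rewrite ?sqr_ge0//.
  by rewrite sumr_ge0// => s _; rewrite sqr_ge0.
apply/ler_addgt0Pl => e e0; have d1 : 0 < nu * C1 + C2 + 1 by rewrite ltr_wpDl.
have := key _ (divr_gt0 e0 d1); rewrite [e + _]addrC => /le_trans; apply.
by rewrite lerD2l mulrAC ler_pdivrMr// ler_pM2l// lerDl.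
Qed.

End Schoenberg.

(** * Approximate representations *)
Lemma kform_dist (R : realType) (X : eqType) (k k' : X -> X -> R)
    (e : R) (l : seq (R * X)) :
  (forall p q, p \in l -> q \in l -> `|k p.2 q.2 - k' p.2 q.2| <= e) ->
  `|kform k l l - kform k' l l| <= e * (\sum_(p <- l) `|p.1|) ^+ 2.
Proof.
move=> kk; rewrite -kformB expr2 mulrCA mulr_suml.
apply: le_trans (ler_norm_sum _ _ _) _.
rewrite big_seq [leRHS]big_seq; apply: ler_sum => p pl.
rewrite normrM ler_wpM2l// mulr_sumr; apply: le_trans (ler_norm_sum _ _ _) _.
rewrite big_seq [leRHS]big_seq; apply: ler_sum => q ql.
by rewrite normrM mulrC ler_wpM2r// kk.
Qed.

Section ApproximateRepresentations.
Context {R : realType} {G : groupType} {H : hilbertType R}.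
Implicit Types (g h : G) (S F : {fset G}) (x y : H) (eps : R).

Lemma opnorm_unitaryB (U V : unitary H) eps x :
  opnorm (fun x => U x - V x) <= eps -> rnorm (U x - V x) <= eps * rnorm x.
Proof.
move=> UV; have [->|x0] := eqVneq x 0.
  by rewrite -(subrr 0) !unitaryB !subrr rnorm0 mulr0.
have n0 : 0 < rnorm x.
  rewrite lt_neqAle rnorm_ge0 andbT eq_sym.
  by apply: contra x0 => /eqP/rnorm_eq0/eqP.
rewrite -ler_pdivrMr//; apply: le_trans UV; apply: ub_le_sup.
  (* The supremum defining [opnorm] dominates its members only for a bounded set; a difference of
     two unitaries is bounded by 2 on the unit ball. *)
  exists 2 => _ [y /= y1 <-]; apply: le_trans (rnormD _ _) _.
  by rewrite rnormN !unitary_rnorm; lra.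
exists ((rnorm x)^-1%:C *: x) => /=.
  by rewrite rnormZ gtr0_norm ?invr_gt0// mulVf ?gt_eqF.
by rewrite !unitaryZ -scalerBr rnormZ gtr0_norm ?invr_gt0// mulrC.
Qed.

Variables (F : {fset G}) (eps : R) (pi : G -> unitary H).
Hypothesis aF : approx_rep F eps pi.

Lemma approx_repV g x y : g \in F -> rinner (pi (g^-1)%g x) y = rinner x (pi g y).
Proof.
by move=> gF; rewrite aF.2// rinnerC [RHS]rinnerC; exact/esym/unitary_rinnerV.
Qed.

Lemma approx_repM g h x : g \in F -> h \in F ->
  rnorm (pi (g * h)%g x - pi g (pi h x)) <= eps * rnorm x.
Proof.
by move=> gF hF; exact: (@opnorm_unitaryB _ (pi g * pi h)%g) (aF.1 _ _ gF hF).
Qed.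

Variable x : H.

Definition coef g := rinner (pi g x) x.

Lemma coef_le g : coef g <= rnorm x ^+ 2.
Proof. by apply: le_trans (rinner_le _ _) _; rewrite unitary_rnorm. Qed.

Lemma coefV g : g \in F -> coef (g^-1)%g = coef g.
Proof. by move=> gF; rewrite /coef approx_repV// rinnerC. Qed.

(** The unitary [pi 1] need not be the identity, but it is almost idempotent, and an almost
    idempotent unitary is close to the identity. *)
Lemma coef1 : 1%g \in F -> `|rnorm x ^+ 2 - coef 1%g| <= eps * rnorm x ^+ 2.
Proof.
move=> F1; have := approx_repM x F1 F1; rewrite mulg1 => h.
have cE : rnorm x ^+ 2 - coef 1%g = rinner (pi 1%g x - pi 1%g (pi 1%g x)) (pi 1%g x).
  by rewrite -unitaryB unitary_rinner rinnerBl rinner_diag.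
rewrite ger0_norm ?subr_ge0 ?coef_le// cE; apply: le_trans (rinner_le _ _) _.
by rewrite unitary_rnorm expr2 mulrA ler_wpM2r ?rnorm_ge0.
Qed.

Lemma coefM g h : g \in F -> h \in F ->
  `|coef (g * h)%g - rinner (pi g (pi h x)) x| <= eps * rnorm x ^+ 2.
Proof.
move=> gF hF; have le y : rnorm y <= eps * rnorm x -> rinner y x <= eps * rnorm x ^+ 2.
  move=> yx; apply: le_trans (rinner_le _ _) _.
  by rewrite expr2 mulrA ler_wpM2r ?rnorm_ge0.
rewrite /coef -rinnerBl ler_norml lerNl -rinnerNl !le ?rnormN//; exact: approx_repM.
Qed.

Lemma coefVM g h : g \in F -> (g^-1)%g \in F -> h \in F ->
  `|coef (g^-1 * h)%g - rinner (pi h x) (pi g x)| <= eps * rnorm x ^+ 2.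
Proof. by move=> gF gVF hF; have := coefM gVF hF; rewrite approx_repV. Qed.

Lemma displacement_coef g : rnorm (pi g x - x) ^+ 2 = 2 * (rnorm x ^+ 2 - coef g).
Proof.
rewrite /coef -!rinner_diag rinnerBl !rinnerBr unitary_rinner (rinnerC x); ring.
Qed.

(** Triangle inequality for displacements; the 2 comes from (a + b)^2 <= 2 a^2 + 2 b^2. It carries
    bounds from generators to their products. *)
Lemma coef_subadd g h : g \in F -> h \in F ->
  rnorm x ^+ 2 - coef (g * h)%g <= 2 * (rnorm x ^+ 2 - coef g) +
    2 * (rnorm x ^+ 2 - coef h) + eps * rnorm x ^+ 2.
Proof.
move=> gF hF; have := coefM gF hF; rewrite ler_norml => /andP[+ _].
have -> : rinner (pi g (pi h x)) x = rnorm x ^+ 2 - rnorm (pi g (pi h x) - x) ^+ 2 / 2.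
  by rewrite -!rinner_diag rinnerBl !rinnerBr !unitary_rinner (rinnerC x); field.
have : rnorm (pi g (pi h x) - x) <= rnorm (pi g x - x) + rnorm (pi h x - x).
  have -> : pi g (pi h x) - x = pi g (pi h x - x) + (pi g x - x).
    by rewrite unitaryB addrA subrK.
  by apply: le_trans (rnormD _ _) _; rewrite unitary_rnorm addrC.
have := displacement_coef g; have := displacement_coef h.
have := rnorm_ge0 (pi g (pi h x) - x).
set a := rnorm (pi g x - x); set b := rnorm (pi h x - x); set d := rnorm _.
move=> d0 hb ha dab.
have : d ^+ 2 <= (a + b) ^+ 2 by rewrite ler_sqr ?nnegrE// (le_trans d0).
have : 0 <= (a - b) ^+ 2 by rewrite sqr_ge0.
lra.
Qed.

(** Up to the error in the group law, the form is the squared norm of the combination [v] of the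
    vectors [pi p.2 x]. *)
Lemma coef_condneg (l : seq (R * G)) :
  (forall p, p \in l -> p.2 \in F /\ (p.2^-1)%g \in F) ->
  - (eps * rnorm x ^+ 2 * (\sum_(p <- l) `|p.1|) ^+ 2) <= kform (gkernel coef) l l.
Proof.
move=> lF; pose v := \sum_(p <- l) p.1%:C *: pi p.2 x.
pose k (g h : G) := rinner (pi h x) (pi g x).
have vE : rinner v v = kform k l l.
  rewrite rinner_suml; apply: eq_bigr => p _; rewrite rinner_sumr mulr_sumr.
  apply: eq_bigr => q _; rewrite rinnerZl rinnerZr; congr (_ * (_ * _)).
  exact: rinnerC.
have : `|kform (gkernel coef) l l - kform k l l| <=
    eps * rnorm x ^+ 2 * (\sum_(p <- l) `|p.1|) ^+ 2.
  apply: kform_dist => p q /lF[pF pVF] /lF[qF _]; exact: coefVM.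
by rewrite ler_norml -vE => /andP[+ _]; have := rinner_ge0 v; lra.
Qed.

Section LaplacianEstimates.
Variable S : {fset G}.
Hypotheses (SF : {subset S <= F}) (symS : symmetric_fset S).

Let v := \sum_(s <- S) (x - pi s x).

Lemma lap_vec1 : rinner v x = \sum_(s <- S) (rnorm x ^+ 2 - coef s).
Proof.
by rewrite rinner_suml; apply: eq_bigr => s _; rewrite rinnerBl rinner_diag.
Qed.

Lemma lap_vec2 : rinner v v = \sum_(r <- S) \sum_(s <- S)
  (rnorm x ^+ 2 - coef r - coef s + rinner (pi s x) (pi r x)).
Proof.
rewrite rinner_suml; apply: eq_bigr => r _; rewrite rinner_sumr.
apply: eq_bigr => s _; rewrite rinnerBl !rinnerBr rinner_diag /coef.
by rewrite (rinnerC x (pi s x)) (rinnerC (pi r x) (pi s x)); ring.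
Qed.

Lemma lap_vec2_coef : `|rinner v v - \sum_(r <- S) \sum_(s <- S)
    (rnorm x ^+ 2 - coef r - coef s + coef (r^-1 * s)%g)| <=
  #|` S|%:R ^+ 2 * (eps * rnorm x ^+ 2).
Proof.
rewrite lap_vec2 -sumrB; apply: le_trans (ler_norm_sum _ _ _) _.
have -> : #|` S|%:R ^+ 2 * (eps * rnorm x ^+ 2) =
    \sum_(r <- S) \sum_(s <- S) (eps * rnorm x ^+ 2).
  rewrite (fset_sum_const S (eps * rnorm x ^+ 2)).
  by rewrite (fset_sum_const S (_ * _)) [RHS]mulrA -expr2.
rewrite big_seq [leRHS]big_seq; apply: ler_sum => r rS; rewrite -sumrB.
apply: le_trans (ler_norm_sum _ _ _) _.
rewrite big_seq [leRHS]big_seq; apply: ler_sum => s sS.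
have := coefVM (SF rS) (SF (symS rS)) (SF sS); rewrite distrC; apply: le_trans.
by rewrite le_eqVlt; apply/orP; left; apply/eqP; congr `|_|; ring.
Qed.

End LaplacianEstimates.
End ApproximateRepresentations.

Lemma fmap_ultra T T' (F : set_system T) (f : T -> T') :
  UltraFilter F -> UltraFilter (f @ F).
Proof.
move=> FU; have FP : ProperFilter F := ultra_proper.
split; first exact: fmap_proper_filter.
move=> G' GF FG; apply/seteqP; split=> // A GA.
have [//|FAc] := in_ultra_setVsetC (f @^-1` A) FU.
have : G' (A `&` ~` A) by apply: filterI => //; exact: FG.
by rewrite setICr => /filter_ex[].
Qed.

Lemma cvg_seq_sum (R : realType) T (F : set_system T) {FF : Filter F}
    (I : Type) (r : seq I) (f : T -> I -> R) (g : I -> R) :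
  (forall i, f t i @[t --> F] --> g i) ->
  \sum_(i <- r) f t i @[t --> F] --> \sum_(i <- r) g i.
Proof.
move=> fg; elim: r => [|i r IHr].
  by rewrite big_nil; under eq_fun do rewrite big_nil; exact: cvg_cst.
by rewrite big_cons; under eq_fun do rewrite big_cons; exact: cvgD.
Qed.

(** * Ultrafilter limits of almost conditionally negative functions *)

Section Limit.
Context {R : realType} {G : groupType}.
Implicit Types (psi : G -> R) (S F : {fset G}) (e b : R).

(** Here [e] is the error and [F] the set on which the group law is controlled. Normalizing the sum
    over [S] to 1 bounds the values on [S] and keeps the limit nonzero. *)
Definition almost_condneg S F e b psi : Prop :=
  [/\ forall g, 0 <= psi g, \sum_(s <- S) psi s = 1,
      {in F, forall g, psi (g^-1)%g = psi g}, psi 1%g <= e &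
  [/\ {in F &, forall g h, psi (g * h)%g <= 2 * psi g + 2 * psi h + e},
      forall l, (forall p, p \in l -> p.2 \in F /\ (p.2^-1)%g \in F) ->
        lincomb (fun=> 1) l = 0 ->
        kform (gkernel psi) l l <= e * (\sum_(p <- l) `|p.1|) ^+ 2 &
      \sum_(r <- S) \sum_(s <- S) (psi r + psi s - psi (r^-1 * s)%g) <=
        b + #|` S|%:R ^+ 2 * e]].

(** The indices are pairs of a finite set and an integer, and the ultrafilter contains all their
    tails: any finite set of group elements is eventually inside [F], and [n * e <= b] forces the
    errors to 0. *)
Lemma almost_condneg_limit S b : generating S ->
  (forall F (n : nat), {subset S <= F} -> 1%g \in F ->
     exists psi e, [/\ 0 <= e, n%:R * e <= b & almost_condneg S F e b psi]) ->
  exists psi, [/\ condneg psi, \sum_(s <- S) psi s = 1 &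
    \sum_(r <- S) \sum_(s <- S) (psi r + psi s - psi (r^-1 * s)%g) <= b].
Proof.
move=> genS ex; pose I := ({fset G} * nat)%type.
pose Fi (i : I) : {fset G} := (i.1 `|` (1%g |` S))%fset.
have {ex} /choice[Psi PsiP] (i : I) : exists p : (G -> R) * R,
    [/\ 0 <= p.2, i.2%:R * p.2 <= b & almost_condneg S (Fi i) p.2 b p.1].
  have [|| psi [e H]] := ex (Fi i) i.2.
  - by move=> s sS; rewrite !inE sS !orbT.
  - by rewrite !inE eqxx orbT.
  - by exists (psi, e).
pose base (i : I) : set I := [set j | (i.1 `<=` j.1)%fset /\ (i.2 <= j.2)%N].
pose FF := filter_from [set: I] base.
have FP : ProperFilter FF.
  apply: filter_from_proper; last by move=> i _; exists i; split.
  apply: filter_from_filter; first by exists (fset0, 0%N).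
  move=> i j _ _; exists (i.1 `|` j.1, maxn i.2 j.2)%fset => // k [].
  by rewrite /= fsubUset geq_max => /andP[? ?] /andP[? ?]; split; split.
have [U [UU FU]] := ultraFilterLemma FP; have UP : ProperFilter U := @ultra_proper _ _ UU.
have Ub i : U (base i) by apply: FU; exists i.
have inF g : U [set i | g \in Fi i].
  apply: filterS (Ub ([fset g]%fset, 0%N)) => j [/= gj _].
  by rewrite !inE -fsub1set gj.
have e0 : (Psi i).2 @[i --> U] --> (0 : R).
  apply/cvgrPdist_le => d d0.
  have := Ub (fset0, (Num.truncn (b / d)).+1).
  apply: filterS => i [_ /= ni]; have [p0 pb _] := PsiP i.
  rewrite sub0r normrN ger0_norm//; have n0 : 0 < i.2%:R :> R.
    by rewrite ltr0n (leq_trans _ ni).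
  rewrite -(ler_pM2l n0); apply: le_trans pb _; rewrite -ler_pdivrMr//.
  apply: le_trans (_ : (Num.truncn (b / d)).+1%:R <= _); last by rewrite ler_nat.
  by rewrite ltW ?truncnS_gt.
have e1 : U [set i | (Psi i).2 <= 1].
  by apply: (cvgr_le _ e0); exact: ltr01.
(* The elements with eventually bounded values form a subgroup: closure under quotients is
   approximate subadditivity together with symmetry under inversion. *)
have bd g : exists M, U [set i | (Psi i).1 g <= M].
  pose K : {pred G} := fun g => `[< exists M, U [set i | (Psi i).1 g <= M] >].
  have /asboolP// : g \in K.
  apply: genS => [|s sS]; last first.
    apply/asboolP; exists 1; apply: filterS filterT => i _ /=.
    have [_ _ [ge0 <- _ _ _]] := PsiP i.
    by rewrite (big_rem s)//= lerDl sumr_ge0.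
  split; first apply/asboolP.
    exists 1; apply: filterS e1 => i /=.
    by have [_ _ [_ _ _ p1 _]] := PsiP i; exact: le_trans.
  move=> x y /asboolP[M xM] /asboolP[M' yM]; apply/asboolP.
  exists (2 * M + 2 * M' + 1).
  near=> i; have [_ _ [_ _ V _ [sub _ _]]] := PsiP i.
  have : (Psi i).1 (x / y)%g <= 2 * (Psi i).1 x + 2 * (Psi i).1 (y^-1)%g + (Psi i).2.
    by apply: sub; near: i; exact: inF.
  rewrite V; last by near: i; exact: inF.
  have : (Psi i).1 x <= M by near: i.
  have : (Psi i).1 y <= M' by near: i.
  have : (Psi i).2 <= 1 by near: i.
  rewrite /=; lra.
(* Compactness of [[0, M]] in its ultrafilter form. *)
have lim_ex (g : G) : exists a : R, (Psi i).1 g @[i --> U] --> a.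
  have [M gM] := bd g.
  have := @segment_compact R 0 M; rewrite compact_ultra => cpt.
  have [||a [_ ga]] := cpt ((fun i => (Psi i).1 g) @ U) _ _.
  - exact: fmap_ultra.
  - apply: (@filterS _ U _ _ _ _ gM) => i /= iM; rewrite in_itv/= iM andbT.
    by have [_ _ []] := PsiP i.
  - by exists a.
have [psi psiP] := choice lim_ex.
exists psi; split; first split.
- apply/eqP; rewrite eq_le; apply/andP; split.
    have c : (Psi i).1 1%g - (Psi i).2 @[i --> U] --> psi 1%g - 0.
      exact: cvgB.
    rewrite -[psi _]subr0; apply: (cvgr_to_le c); near=> i.
    by have [_ _ [_ _ _ p1 _]] := PsiP i; rewrite subr_le0.
  apply: (cvgr_to_ge (psiP 1%g)); near=> i.
  by have [_ _ [p0 _ _ _ _]] := PsiP i.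
- move=> g; have c : (Psi i).1 (g^-1)%g - (Psi i).1 g @[i --> U] --> psi (g^-1)%g - psi g.
    exact: cvgB.
  have E : \forall i \near U, (Psi i).1 (g^-1)%g - (Psi i).1 g = 0.
    near=> i; have [_ _ [_ _ V _ _]] := PsiP i; rewrite V ?subrr//.
    by near: i; exact: inF.
  apply/eqP; rewrite -subr_eq0 eq_le (cvgr_to_le c) ?(cvgr_to_ge c)//.
    by apply: filterS E => i ->.
  by apply: filterS E => i ->.
- move=> l l0; set C := (\sum_(p <- l) `|p.1|) ^+ 2.
  have c : kform (gkernel (Psi i).1) l l - (Psi i).2 * C @[i --> U] -->
      kform (gkernel psi) l l - 0 * C.
    apply: cvgB; last by apply: cvgM e0 _; exact: cvg_cst.
    by apply: cvg_lincomb => x; apply: cvg_lincomb => y; exact: psiP.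
  rewrite -[kform _ _ _]subr0 -[X in _ - X](mul0r C); apply: (cvgr_to_le c).
  have lF : \forall i \near U, forall p, p \in l -> p.2 \in Fi i /\ (p.2^-1)%g \in Fi i.
    elim: (l) => [|p l' IH]; first exact: nearW.
    apply: filterS (filterI IH (filterI (inF p.2) (inF (p.2^-1)%g))).
    by move=> i [h [pF pVF]] q; rewrite inE => /predU1P[->|/h].
  near=> i; have [_ _ [_ _ _ _ [_ cn _]]] := PsiP i.
  by rewrite subr_le0 cn//; near: i.
- have c : \sum_(s <- S) (Psi i).1 s @[i --> U] --> \sum_(s <- S) psi s.
    exact: cvg_seq_sum.
  apply/eqP; rewrite eq_le (cvgr_to_le c) ?(cvgr_to_ge c)//.
    by near=> i; have [_ _ [_ -> _ _ _]] := PsiP i.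
  by near=> i; have [_ _ [_ -> _ _ _]] := PsiP i.
- have c : \sum_(r <- S) \sum_(s <- S)
      ((Psi i).1 r + (Psi i).1 s - (Psi i).1 (r^-1 * s)%g)
      - #|` S|%:R ^+ 2 * (Psi i).2 @[i --> U] -->
      \sum_(r <- S) \sum_(s <- S) (psi r + psi s - psi (r^-1 * s)%g) - #|` S|%:R ^+ 2 * 0.
    apply: cvgB; last by apply: cvgM e0; exact: cvg_cst.
    apply: cvg_seq_sum => r; apply: cvg_seq_sum => s.
    by apply: cvgB; [exact: cvgD|].
  rewrite -[leLHS]subr0 -[X in _ - X](mulr0 (#|` S|%:R ^+ 2)); apply: (cvgr_to_le c).
  by near=> i; have [_ _ [_ _ _ _ [_ _ h]]] := PsiP i; rewrite lerBlDr.
Unshelve. all: by end_near. Qed.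

End Limit.

(** * The gap inequality for approximate representations *)

Section ApproximateGap.
Context {R : realType} {G : groupType}.
Implicit Types (S F : {fset G}).

Lemma approx_almost_condneg S F eps (b : R) (H : hilbertType R)
    (pi : G -> unitary H) (x : H) (v := \sum_(s <- S) (x - pi s x)) :
  {subset S <= F} -> symmetric_fset S -> 1%g \in F -> approx_rep F eps pi ->
  0 < rinner v x -> rinner v v <= b * rinner v x ->
  almost_condneg S F (eps * rnorm x ^+ 2 / rinner v x) b
    (fun g => (rnorm x ^+ 2 - coef pi x g) / rinner v x).
Proof.
move=> SF symS F1 aF t0 vb; set t := rinner v x in t0 vb *.
set e := eps * rnorm x ^+ 2; set n := rnorm x ^+ 2.
split.
- by move=> g; rewrite divr_ge0 ?(ltW t0)// subr_ge0 coef_le.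
- by rewrite -mulr_suml -lap_vec1 divff// gt_eqF.
- by move=> g gF; rewrite (coefV aF).
- rewrite ler_pM2r ?invr_gt0//.
  by have := coef1 aF x F1; rewrite ler_norml => /andP[].
split.
- move=> g h gF hF; have := coef_subadd aF x gF hF.
  rewrite -/e -/n -(ler_pM2r (_ : 0 < t^-1)) ?invr_gt0//; lra.
- move=> l lF l0.
  have -> : kform (gkernel (fun g => (n - coef pi x g) / t)) l l =
      - kform (gkernel (coef pi x)) l l / t.
    have E : kform (gkernel (fun g => (n - coef pi x g) / t)) l l =
        kform (fun g h => (n / t) * (1 * 1) - t^-1 * gkernel (coef pi x) g h) l l.
      apply: eq_lincomb => g; apply: eq_lincomb => h.
      by rewrite /gkernel mulrBl !mulr1 [t^-1 * _]mulrC.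
    rewrite E kformB.
    have kZ c (k : G -> G -> R) : kform (fun g h => c * k g h) l l = c * kform k l l.
      by rewrite /kform -lincombZ; apply: eq_lincomb => g; exact: lincombZ.
    (* The constant part of the kernel contributes a multiple of the squared total weight, which is
       0. *)
    have -> : kform (fun _ _ : G => n / t * (1 * 1)) l l = 0.
      have := kform_rank1 (fun=> 1) l; rewrite l0 expr0n => h.
      by rewrite (kZ _ (fun _ _ => 1 * 1)) h mulr0.
    by rewrite kZ sub0r mulNr mulrC.
  rewrite mulrAC ler_pM2r ?invr_gt0//.
  by have := coef_condneg aF x lF; rewrite -/e; lra.
have := lap_vec2_coef aF x SF symS; rewrite -/v -/e ler_norml => /andP[+ _].
have -> : \sum_(r <- S) \sum_(s <- S) ((n - coef pi x r) / t + (n - coef pi x s) / t -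
      (n - coef pi x (r^-1 * s)%g) / t) =
    (\sum_(r <- S) \sum_(s <- S) (n - coef pi x r - coef pi x s +
      coef pi x (r^-1 * s)%g)) / t.
  rewrite mulr_suml; apply: eq_bigr => r _; rewrite mulr_suml.
  by apply: eq_bigr => s _; ring.
set L := \sum_(r <- S) _ => h; rewrite ler_pdivrMr// mulrDl mulrA divfK ?gt_eqF//.
lra.
Qed.

Lemma approx_gap S (kappa : R) : symmetric_fset S -> generating S ->
  kazhdan_constant S kappa ->
  exists (F : {fset G}) (C : R), [/\ {subset S <= F}, 0 <= C &
    forall (eps : R) (H : hilbertType R) (pi : G -> unitary H),
      0 < eps -> approx_rep F eps pi ->
      forall x (v := \sum_(s <- S) (x - pi s x)),
        kappa ^+ 2 / 2 * rinner v x <= rinner v v + C * eps * rnorm x ^+ 2].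
Proof.
move=> symS genS kS; have [k2|k2] := leP 2 kappa.
  exists (1%g |` S)%fset.
  (* The first term pays for putting [coef 1] in place of the squared norm in the first order sum;
     the second covers the error in the double sum. *)
  exists (kappa ^+ 2 / 2 * #|` S|%:R + #|` S|%:R ^+ 2 * 2).
  have b0 : 0 <= kappa ^+ 2 / 2 by rewrite divr_ge0// sqr_ge0.
  split=> [s sS||eps H pi eps0 aF x /=].
  - by rewrite !inE sS orbT.
  - by rewrite addr_ge0// mulr_ge0// ?exprn_ge0// ler0n.
  have SF : {subset S <= (1%g |` S)%fset} by move=> s sS; rewrite !inE sS orbT.
  have F1 : 1%g \in (1%g |` S)%fset by rewrite !inE eqxx.
  rewrite lap_vec1.
  have := lap_vec2_coef aF x SF symS; rewrite ler_norml => /andP[+ _].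
  have := kazhdan_ge2 symS kS k2 (coef pi x).
  have := coef1 aF x F1; set d := rnorm x ^+ 2 - coef pi x 1%g.
  rewrite ler_norml => /andP[_ de].
  have -> : \sum_(s <- S) (rnorm x ^+ 2 - coef pi x s) =
      lap1 S (coef pi x) + #|` S|%:R * d.
    rewrite -fset_sum_const -big_split; apply: eq_bigr => s _ /=; rewrite /d; ring.
  have -> : \sum_(r <- S) \sum_(s <- S) (rnorm x ^+ 2 - coef pi x r - coef pi x s +
      coef pi x (r^-1 * s)%g) = lap2 S (coef pi x) + #|` S|%:R * (#|` S|%:R * d).
    rewrite -!fset_sum_const -big_split; apply: eq_bigr => r _ /=.
    rewrite -big_split; apply: eq_bigr => s _ /=; rewrite /d; ring.
  set e := eps * rnorm x ^+ 2 in de *; set N := #|` S|%:R; set b := kappa ^+ 2 / 2.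
  have d0 : 0 <= d by rewrite subr_ge0 coef_le.
  have N0 : 0 <= N by rewrite ler0n.
  have h1 : b * (N * d) <= b * (N * e) by rewrite ler_wpM2l// ler_wpM2l.
  have h2 : N * (N * d) <= N * (N * e) by rewrite !ler_wpM2l.
  move=> h3 h4; rewrite -mulrA -/e mulrDr h3.
  set L := rinner _ _ in h4 *; have : 0 <= N * (N * d) by rewrite !mulr_ge0.
  nra.
have [nu nuk gap] := kazhdan_gap symS kS k2.
apply: contrapT => nex.
have b0 : 0 < kappa ^+ 2 / 2 by rewrite divr_gt0// exprn_gt0// kS.1.
have [|psi [cn psi1 psi2]] := @almost_condneg_limit R G S (kappa ^+ 2 / 2) genS.
- move=> F n SF F1; apply: contrapT => nF; apply: nex.
  exists F, n%:R; split=> // eps H pi eps0 aF x /=.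
  rewrite leNgt; apply/negP => lt; apply: nF.
  set v := \sum_(s <- S) _ in lt.
  (* The failure [lt] reads |v|^2 + n eps |x|^2 < (kappa^2 / 2) <v, x>. It yields positivity of <v,
     x>, the bound kappa^2 / 2 on n times the relative error, and |v|^2 <= (kappa^2 / 2) <v, x>. *)
  have e0 : 0 <= n%:R * eps * rnorm x ^+ 2.
    by rewrite mulr_ge0 ?sqr_ge0// mulr_ge0// ltW.
  have vv := rinner_ge0 v.
  have t0 : 0 < rinner v x.
    by rewrite -(pmulr_rgt0 _ b0); apply: le_lt_trans lt; rewrite addr_ge0.
  exists (fun g => (rnorm x ^+ 2 - coef pi x g) / rinner v x).
  exists (eps * rnorm x ^+ 2 / rinner v x); split.
  + by rewrite divr_ge0 ?(ltW t0)// mulr_ge0 ?sqr_ge0// ltW.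
  + by rewrite mulrA ler_pdivrMr//; lra.
  + by apply: approx_almost_condneg => //; rewrite -/v; lra.
have nu0 : 0 <= nu by rewrite (le_trans (ltW b0))// ltW.
have := condneg_lap cn nu0 gap; rewrite psi1 mulr1 leNgt => /negP; apply.
exact: le_lt_trans psi2 nuk.
Qed.

End ApproximateGap.

(** * The spectrum of the Laplacian *)

Section Spectrum.
Context {R : realType} {H : hilbertType R}.
Implicit Types (x y : H) (z : R[i]).

Lemma rnormZc z x : rnorm (z *: x) = complex.Re `|z| * rnorm x.
Proof.
apply: complexI; rewrite rmorphM [X in X * _]RRe_real ?normr_real//.
by rewrite -[RHS]/(`|z| * (rnorm x)%:C) -!normE normrZ.
Qed.

(** Banach's fixed point theorem for the affine map [L x + y], iterated from 0. *)
Lemma contraction_solve (L : H -> H) (q : R) y :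
  (forall x x', L (x - x') = L x - L x') -> 0 <= q < 1 ->
  (forall x, rnorm (L x) <= q * rnorm x) -> exists x, x = L x + y.
Proof.
move=> LB /andP[q0 q1] Lq; pose s n := iter n (fun x => L x + y) 0.
have q1' : 0 < 1 - q by rewrite subr_gt0.
pose M := rnorm y / (1 - q).
have M0 : 0 <= M by rewrite divr_ge0 ?rnorm_ge0// ltW.
have sM n : rnorm (s n) <= M.
  elim: n => [|n IHn]; first by rewrite rnorm0.
  apply: le_trans (rnormD _ _) _; apply: le_trans (_ : q * M + rnorm y <= _).
    by rewrite lerD2r (le_trans (Lq _))// ler_wpM2l.
  have : M * (1 - q) = rnorm y by rewrite divfK// gt_eqF.
  lra.
have sN N k : rnorm (s (N + k)%N - s N) <= q ^+ N * M.
  elim: N => [|N IHN]; first by rewrite add0n subr0 expr0 mul1r.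
  rewrite addSn /= opprD addrACA subrr addr0 -LB exprS -mulrA.
  by apply: le_trans (Lq _) _; rewrite ler_wpM2l.
have qM e : 0 < e -> exists N, q ^+ N * M < e.
  move=> e0; have : (fun n => q ^+ n * M) @ \oo --> 0 * M.
    by apply: cvgM; [apply: cvg_expr; rewrite ger0_norm|exact: cvg_cst].
  rewrite mul0r => h; have [N _ hN] := cvgr_lt _ h _ e0; exists N.
  exact: hN (leqnn N).
have cs : cvg (s @ \oo).
  apply: cauchy_cvg; apply: cauchy_exP => e e0.
  have eE : e = (complex.Re e)%:C by rewrite RRe_real// gtr0_real.
  move: e0; rewrite eE ltcR => /qM[N hN]; exists (s N).
  exists N => // n /= Nn; rewrite -ball_normE/= normE ltcR -rnormN opprB.
  by apply: le_lt_trans hN; rewrite -(subnKC Nn).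
exists (lim (s @ \oo)); set l := lim _.
apply/eqP; rewrite -subr_eq0; apply/eqP/rnorm_eq0/eqP.
rewrite eq_le rnorm_ge0 andbT; apply/ler_addgt0Pl => e e0; rewrite addr0.
have e2 : 0 < (e / 2)%:C :> R[i] by rewrite ltcR divr_gt0.
have sl : s @ \oo --> l by exact: cs.
move/cvgrPdist_lt : sl => /(_ _ e2)[N _ hN].
have lt n : (N <= n)%N -> rnorm (l - s n) < e / 2.
  by move=> /hN /=; rewrite normE ltcR.
have -> : l - (L l + y) = (l - s N.+1) + L (s N - l).
  rewrite LB /= -addrA; congr (l + _).
  by rewrite [L (s N) + y]addrC [in RHS]opprD [RHS]addrA subrK opprD addrC.
apply: le_trans (rnormD _ _) _; apply: le_trans (_ : e / 2 + 1 * (e / 2) <= _).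
  apply: lerD; first exact/ltW/lt.
  apply: le_trans (Lq _) _; rewrite -rnormN opprB.
  by apply: ler_pM; rewrite ?rnorm_ge0// ltW// lt.
lra.
Qed.

Section SelfAdjoint.
Variables (A : H -> H) (M : R).
Hypothesis A_linear : linear A.
Hypothesis A_sym : forall x y, inner (A x) y = inner x (A y).
Hypothesis A_bounded : forall x, rnorm (A x) <= M * rnorm x.

Definition resolvent_op z x := z *: x - A x.

Local Notation B := resolvent_op.

Lemma resolvent_op_linear z : linear (B z).
Proof.
move=> a x y; rewrite /B A_linear scalerDr scalerBr !scalerA [z * a]mulrC.
by rewrite opprD addrACA.
Qed.

Lemma resolvent_opB z x y : B z (x - y) = B z x - B z y.
Proof. exact: (zmod_morphism_linear (resolvent_op_linear z)). Qed.

Lemma resolvent_opM z w x :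
  B z (B w x) = (z * w) *: x - (z + w) *: A x + A (A x).
Proof.
have AB u v : A (u - v) = A u - A v by exact: (zmod_morphism_linear A_linear).
have AZ a u : A (a *: u) = a *: A u by exact: (scalable_linear A_linear).
rewrite /B AB AZ scalerBr scalerA scalerDl !opprD opprK addrA.
by congr (_ + _); rewrite -!addrA.
Qed.

Lemma resolvent_op_adjoint z x y :
  rinner (B z x) y = rinner x (B (Num.conj z) y).
Proof.
rewrite /B rinnerBl rinnerBr; congr (_ - _); last by rewrite /rinner A_sym.
rewrite /rinner innerZl; congr complex.Re.
by rewrite [RHS]innerC innerZl rmorphM /= conjCK -innerC.
Qed.

(** Symmetry of [A] makes the cross terms cancel. Consequently a nonzero imaginary part bounds the
    operator from below, and conjugating [z] does not change norms. *)
Lemma resolvent_op_sqnorm (a b : R) x :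
  rnorm (B (a +i* b) x) ^+ 2 = rnorm (B a%:C x) ^+ 2 + b ^+ 2 * rnorm x ^+ 2.
Proof.
rewrite -!rinner_diag !resolvent_op_adjoint !resolvent_opM -rinnerZr -rinnerDr.
have -> : Num.conj (a +i* b) * (a +i* b) = a%:C * a%:C + (b ^+ 2)%:C.
  by apply/eqP; rewrite eq_complex /=; apply/andP; split; apply/eqP; ring.
have -> : Num.conj (a%:C : R[i]) = a%:C by exact: conjc_real.
have -> : Num.conj (a +i* b) + (a +i* b) = a%:C + a%:C.
  by apply/eqP; rewrite eq_complex /=; apply/andP; split; apply/eqP; ring.
by congr (rinner x _); rewrite scalerDl [RHS](ACl (1*4*2*3)).
Qed.

Lemma resolvent_op_conj_norm z x : rnorm (B (Num.conj z) x) = rnorm (B z x).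
Proof.
apply/eqP; rewrite -(@eqrXn2 _ 2) ?rnorm_ge0//; case: z => a b.
have -> : Num.conj (a +i* b) = a +i* (- b) by [].
by rewrite (resolvent_op_sqnorm a (- b)) (resolvent_op_sqnorm a b) sqrrN.
Qed.

(** A lower bound gives injectivity and a bounded inverse on the range. For surjectivity, [T], the
    product of [B z] with its adjoint, is coercive, and [T x = y] is solved by damped iteration. *)
Lemma not_in_spectrum z c : 0 < c ->
  (forall x, c * rnorm x <= rnorm (B z x)) -> ~ spectrum A z.
Proof.
move=> c0 Bc; apply.
have Binj x y : B z x = B z y -> x = y.
  move=> xy; apply/eqP; rewrite -subr_eq0; apply/eqP/rnorm_eq0/eqP.
  rewrite eq_le rnorm_ge0 andbT -(pmulr_rle0 _ c0).
  by apply: le_trans (Bc _) _; rewrite resolvent_opB xy subrr rnorm0.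
pose T x := B (Num.conj z) (B z x).
pose K := (complex.Re `|z| + `|M| + 1 + c).
have z0 : 0 <= complex.Re `|z|.
  by rewrite -lecR RRe_real ?normr_ge0// normr_real.
have cK : c < K by have := normr_ge0 M; rewrite /K; lra.
have K0 : 0 < K := lt_trans c0 cK.
have BK x : rnorm (B z x) <= K * rnorm x.
  apply: le_trans (rnormD _ _) _; rewrite rnormN rnormZc.
  have := A_bounded x; have : M * rnorm x <= `|M| * rnorm x.
    by rewrite ler_wpM2r ?rnorm_ge0 ?ler_norm.
  have : 0 <= c * rnorm x by rewrite mulr_ge0 ?rnorm_ge0 ?ltW.
  have := rnorm_ge0 x.
  rewrite /K; lra.
have TK x : rnorm (T x) <= K ^+ 2 * rnorm x.
  rewrite /T resolvent_op_conj_norm; apply: le_trans (BK _) _.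
  by rewrite expr2 -mulrA ler_pM2l.
have Tx x : c ^+ 2 * rnorm x ^+ 2 <= rinner (T x) x.
  rewrite /T resolvent_op_adjoint conjCK rinner_diag -exprMn.
  by rewrite ler_sqr ?nnegrE ?rnorm_ge0// mulr_ge0 ?rnorm_ge0// ltW.
have TB u v : T (u - v) = T u - T v by rewrite /T (resolvent_opB z u) resolvent_opB.
have surj y : exists x, B z x = y.
  (* This damping [al] minimizes 1 - 2 al c^2 + al^2 K^4, which bounds the squared contraction
     factor; the minimum is [1 - d]. *)
  pose d := c ^+ 4 / K ^+ 4; pose al := c ^+ 2 / K ^+ 4.
  have d0 : 0 < d by rewrite divr_gt0 ?exprn_gt0.
  have d1 : d <= 1.
    by rewrite ler_pdivrMr ?exprn_gt0// mul1r lerXn2r ?nnegrE ?ltW.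
  have al0 : 0 < al by rewrite divr_gt0 ?exprn_gt0.
  pose L x := x - al%:C *: T x.
  have [|||x xE] := @contraction_solve L (Num.sqrt (1 - d)) (al%:C *: y).
  - move=> u v; rewrite /L TB scalerBr !opprB addrACA [RHS]addrACA.
    by congr (_ + _); exact: addrC.
  - rewrite sqrtr_ge0; apply: lt_of_sqr => //.
    by rewrite sqr_sqrtr ?subr_ge0// expr1n gtrBl.
  - move=> u; apply: le_of_sqr; first by rewrite mulr_ge0 ?sqrtr_ge0 ?rnorm_ge0.
    rewrite exprMn sqr_sqrtr ?subr_ge0// -rinner_diag /L.
    have key (w : H) : rinner (u - al%:C *: w) (u - al%:C *: w) =
        rnorm u ^+ 2 - 2 * (al * rinner w u) + al ^+ 2 * rnorm w ^+ 2.
      rewrite !(rinnerBl, rinnerBr, rinnerZl, rinnerZr) !rinner_diag.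
      by rewrite (rinnerC u); ring.
    rewrite key.
    have h1 : al * (c ^+ 2 * rnorm u ^+ 2) <= al * rinner (T u) u by rewrite ler_pM2l.
    have h2 : al ^+ 2 * rnorm (T u) ^+ 2 <= al ^+ 2 * (K ^+ 2 * rnorm u) ^+ 2.
      rewrite ler_pM2l ?exprn_gt0// ler_sqr ?nnegrE ?rnorm_ge0//.
      by rewrite mulr_ge0 ?rnorm_ge0// exprn_ge0// ltW.
    have e1 : al * (c ^+ 2 * rnorm u ^+ 2) = d * rnorm u ^+ 2.
      by rewrite /al /d; ring.
    have e2 : al ^+ 2 * (K ^+ 2 * rnorm u) ^+ 2 = d * rnorm u ^+ 2.
      by rewrite /al /d; field; rewrite gt_eqF.
    rewrite e1 in h1; rewrite e2 in h2; lra.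
  (* [B z] and its adjoint commute, so solving for [T] solves for [B z]. *)
  exists (B (Num.conj z) x).
  have -> : B z (B (Num.conj z) x) = T x.
    by rewrite /T [LHS]resolvent_opM [RHS]resolvent_opM mulrC [z + _]addrC.
  have : al%:C *: (y - T x) = 0.
    have : x - L x = al%:C *: y by rewrite {1}xE addrC addKr.
    have -> : x - L x = al%:C *: T x by exact: subKr.
    by move=> h; rewrite (scalerBr _ y) h subrr.
  move=> /eqP; rewrite scaler_eq0 (_ : (al%:C == 0) = false) /=; last first.
    by rewrite gt_eqF// ltcR.
  by rewrite subr_eq0 eq_sym => /eqP.
have [U UE] := choice surj.
have Ulin : linear U.
  move=> a x y; apply: Binj; rewrite resolvent_op_linear !UE //.
pose Um := GRing.isLinear.Build _ _ _ _ U Ulin.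
pose UL : {linear H -> H} := HB.pack U Um.
exists UL; split => //=.
- move=> x; apply/cvgrPdist_lt => e e0.
  have eE : e = (complex.Re e)%:C by rewrite RRe_real// gtr0_real.
  move: e0; rewrite eE ltcR => e0.
  have r0 : 0 < (c * complex.Re e)%:C :> R[i] by rewrite ltcR mulr_gt0.
  apply: filterS (nbhsx_ballx x _ r0) => y.
  rewrite -ball_normE /= !normE !ltcR -[x in rnorm x < _]UE => xy.
  rewrite -(ltr_pM2l c0); apply: le_lt_trans xy; apply: le_trans (Bc _) _.
  by rewrite resolvent_opB !UE.
- by move=> x; apply: Binj; rewrite UE.
Qed.
End SelfAdjoint.
End Spectrum.

(** * Self-adjointness and bounds of the Laplacian *)

Section LaplacianSpectrum.
Context {R : realType} {G : groupType} {H : hilbertType R}.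
Variables (S : {fset G}) (pi : G -> unitary H).
Hypotheses (symS : symmetric_fset S)
  (piV : {in S, forall s, pi (s^-1)%g = ((pi s)^-1)%g}).

Local Notation A := (laplacian S pi).
Local Notation N := (#|` S|%:R).

Lemma laplacian_linear : linear A.
Proof.
move=> a x y; rewrite /laplacian.
have -> : \sum_(s <- S) pi s (a *: x + y) =
    a *: (\sum_(s <- S) pi s x) + \sum_(s <- S) pi s y.
  rewrite scaler_sumr -big_split; apply: eq_bigr => s _.
  by rewrite unitaryD unitaryZ.
by rewrite scalerDr scalerA [_ * a]mulrC -scalerA opprD addrACA -scalerBr.
Qed.

Lemma fset_sum_inv (V : nmodType) (f : G -> V) :
  \sum_(s <- S) f (s^-1)%g = \sum_(s <- S) f s.
Proof.
rewrite -(big_map (fun s => s^-1)%g xpredT); apply: perm_big.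
apply: uniq_perm; rewrite ?map_inj_uniq ?fset_uniq//; first exact: invg_inj.
move=> s; apply/mapP/idP => [[t tS ->]|sS]; first exact: symS.
by exists (s^-1)%g; rewrite ?invgK//; exact: symS.
Qed.

Lemma cpx_natV n : (n%:R : R[i])^-1 = ((n%:R : R)^-1)%:C.
Proof. by rewrite fmorphV rmorph_nat. Qed.

Lemma laplacian_innerl x y :
  inner (A x) y = inner x y - N^-1 * \sum_(s <- S) inner (pi s x) y.
Proof.
have inner0 : inner (0 : H) y = 0.
  by have := innerZl 0 (0 : H) y; rewrite scale0r mul0r.
have sumE : inner (\sum_(s <- S) pi s x) y = \sum_(s <- S) inner (pi s x) y.
  elim: (enum_fset S) => [|s r IHr]; first by rewrite !big_nil.
  by rewrite !big_cons innerDl IHr.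
by rewrite /laplacian -scaleNr innerDl innerZl sumE mulNr.
Qed.

Lemma laplacian_sym x y : inner (A x) y = inner x (A y).
Proof.
rewrite [RHS]innerC !laplacian_innerl rmorphB rmorphM /= -innerC; congr (_ - _ * _).
  by rewrite cpx_natV; exact/esym/conjc_real.
rewrite rmorph_sum -fset_sum_inv big_seq [RHS]big_seq; apply: eq_bigr => s sS.
have [adj _ _] := unitary_adjP (pi (s^-1)%g).
transitivity (inner x (pi s y)); last exact: innerC.
have -> : pi s = ((pi (s^-1)%g)^-1)%g by rewrite piV// invgK.
exact: adj.
Qed.

Lemma laplacian_norm x : rnorm (A x) <= 2 * rnorm x.
Proof.
have sumE : rnorm (\sum_(s <- S) pi s x) <= N * rnorm x.
  rewrite -fset_sum_const.
  elim: (enum_fset S) => [|s r IHr]; first by rewrite !big_nil rnorm0.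
  rewrite !big_cons; apply: le_trans (rnormD _ _) _.
  by rewrite unitary_rnorm lerD2l.
apply: le_trans (rnormD _ _) _; rewrite rnormN cpx_natV rnormZ.
rewrite ger0_norm ?invr_ge0 ?ler0n// mulr_natl mulr2n lerD2l.
have [N0|N0] := eqVneq (N : R) 0; first by rewrite N0 invr0 mul0r rnorm_ge0.
by rewrite ler_pdivrMl// lt_neqAle eq_sym N0 ler0n.
Qed.

Lemma laplacian_vec x : (0 < #|` S|)%N ->
  (N : R)%:C *: A x = \sum_(s <- S) (x - pi s x).
Proof.
move=> N0; rewrite sumrB /laplacian scalerBr cpx_natV scalerA -rmorphM.
rewrite divff ?pnatr_eq0 -?lt0n// scale1r; congr (_ - _).
rewrite -(mulr1 (N : R)) -fset_sum_const rmorph_sum scaler_suml.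
by apply: eq_bigr => s _; rewrite scale1r.
Qed.

(** Places the numerical range in [0, 2], which excludes real spectrum outside that interval. *)
Lemma laplacian_rinner x :
  `|rnorm x ^+ 2 - rinner (A x) x| <= rnorm x ^+ 2.
Proof.
have -> : rnorm x ^+ 2 - rinner (A x) x = N^-1 * \sum_(s <- S) rinner (pi s x) x.
  rewrite /laplacian rinnerBl rinner_diag subKr cpx_natV rinnerZl.
  by rewrite rinner_suml.
rewrite normrM ger0_norm ?invr_ge0 ?ler0n//.
have [N0|N0] := eqVneq (N : R) 0; first by rewrite N0 invr0 mul0r sqr_ge0.
rewrite ler_pdivrMl; last by rewrite lt_neqAle eq_sym N0 ler0n.
apply: le_trans (ler_norm_sum _ _ _) _; rewrite -fset_sum_const.
apply: ler_sum => s _; rewrite ler_norml lerNl -rinnerNl.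
apply/andP; split; apply: le_trans (rinner_le _ _) _;
  by rewrite ?rnormN unitary_rnorm.
Qed.

End LaplacianSpectrum.

Theorem theorem7p10 (R : realType) (G : groupType) (GT : property_T R G)
    (S : {fset G}) (symS : symmetric_fset S) (genS : generating S)
    (kappa : R) (kappaS : kazhdan_constant S kappa) :
  let lambda : R := kappa ^+ 2 / (2 * #|` S|%:R) in
  exists (F : {fset G}) (C : R),
    {subset S <= F} /\
    forall (eps : R) (H : hilbertType R) (pi : G -> unitary H),
      0 < eps ->
      approx_rep F eps pi ->
      spectrum (laplacian S pi) `<=`
        [set r%:C | r in `[0, C * eps] `|` `[lambda - C * eps, 2]].
Proof.
move=> lambda; have [F [C0 [SF C00 gap]]] := approx_gap symS genS kappaS.
(* The vector in [approx_gap] is [#|S|] times the Laplacian of [x], so its inequality is divided by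
   [#|S|] squared. *)
pose C' := C0 / #|` S|%:R ^+ 2.
(* If [a] and [lambda - a] both exceed C eps, the larger one is at least lambda / 2, so their
   product exceeds C eps lambda / 2, which this choice makes equal to C' eps. *)
exists F, (2 * C' / lambda); split=> // eps H pi eps0 aF z zs.
set C := 2 * C' / lambda.
have piV : {in S, forall s, pi (s^-1)%g = ((pi s)^-1)%g}.
  by move=> s sS; rewrite aF.2// SF.
have notin c : 0 < c ->
    (forall x, c * rnorm x <= rnorm (z *: x - laplacian S pi x)) -> False.
  move=> c0 cx; exact: (not_in_spectrum (laplacian_linear S pi)
    (laplacian_sym symS piV) (laplacian_norm S pi) c0 cx).
have lam0 : 0 <= lambda.
  by rewrite divr_ge0 ?sqr_ge0// mulr_ge0// ler0n.
have C'0 : 0 <= C' by rewrite divr_ge0// exprn_ge0// ler0n.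
have C_ge0 : 0 <= C by rewrite divr_ge0// mulr_ge0.
have [a [b zE]] : exists a b, z = a +i* b by case: z {zs notin} => a b; exists a, b.
have b0 : b = 0.
  apply/eqP; apply: contraT => b0; exfalso; apply: (notin `|b|).
    by rewrite normr_gt0.
  move=> x; apply: le_of_sqr (rnorm_ge0 _) _.
  rewrite -[_ - _]/(resolvent_op (laplacian S pi) z x) zE.
  rewrite (resolvent_op_sqnorm (laplacian_linear S pi) (laplacian_sym symS piV)).
  by rewrite exprMn real_normK ?num_real// lerDr sqr_ge0.
rewrite {}b0 complexr0 in zE; rewrite {}zE in zs notin *.
pose D x := a%:C *: x - laplacian S pi x.
have DE x : rinner (D x) x = a * rnorm x ^+ 2 - rinner (laplacian S pi x) x.
  by rewrite rinnerBl rinnerZl rinner_diag.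
have lap x := laplacian_rinner S pi x.
have a0 : 0 <= a.
  rewrite leNgt; apply/negP => a0; apply: (notin (- a)); first by rewrite oppr_gt0.
  move=> x; apply: le_of_mulr_sqr; rewrite ?rnorm_ge0// -/(D x).
  have := rinner_le (- D x) x; rewrite rnormN rinnerNl DE.
  by have := lap x; rewrite ler_norml => /andP[_]; lra.
have a2 : a <= 2.
  rewrite leNgt; apply/negP => a2; apply: (notin (a - 2)); first by rewrite subr_gt0.
  move=> x; apply: le_of_mulr_sqr; rewrite ?rnorm_ge0//.
  apply: le_trans (rinner_le _ _); rewrite -/(D x) DE.
  by have := lap x; rewrite ler_norml => /andP[+ _]; lra.
exists a => //=; apply: contrapT => /not_orP[].
rewrite /= !in_itv /= a0 a2 andbT /= => /negP; rewrite -ltNge => aC /negP.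
rewrite -ltNge => alam.
(* For empty [S] division by zero gives [lambda = 0], and [alam] then contradicts [a0]. *)
have N0 : (0 < #|` S|)%N.
  rewrite lt0n; apply/negP => /eqP N0; move: alam.
  rewrite /lambda N0 mulr0 invr0 mulr0 sub0r ltNge => /negP; apply.
  by rewrite (le_trans _ a0)// oppr_le0 mulr_ge0// ltW.
have NR0 : 0 < #|` S|%:R :> R by rewrite ltr0n.
have lam1 : 0 < lambda.
  by rewrite divr_gt0 ?exprn_gt0 ?mulr_gt0//; case: kappaS.
have Ceps : C * eps * lambda = 2 * (C' * eps).
  by rewrite /C; field; rewrite gt_eqF.
have Alam x : lambda * rinner (laplacian S pi x) x <=
    rnorm (laplacian S pi x) ^+ 2 + C' * eps * rnorm x ^+ 2.
  have /= := gap _ _ _ eps0 aF x; rewrite -laplacian_vec// !rinnerZl rinnerZr.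
  rewrite rinner_diag -(ler_pM2l (_ : 0 < (#|` S|%:R ^+ 2)^-1)); last first.
    by rewrite invr_gt0 exprn_gt0.
  rewrite le_eqVlt -le_eqVlt; congr (_ <= _); rewrite /lambda /C'; field;
  by rewrite gt_eqF.
(* [Alam] states (Delta - a) (Delta - (lambda - a)) >= d as quadratic forms. Substituting Delta = a
   - D turns it into D^2 + (lambda - 2 a) D >= d, the quadratic inequality that [le_of_quadratic]
   converts into a lower bound for [D]. *)
pose d := a * (lambda - a) - C' * eps.
have d0 : 0 < d.
  rewrite subr_gt0 -(ltr_pM2l (_ : 0 < 2 :> R))// -Ceps.
  have la : C * eps < lambda - a by lra.
  have [al|/ltW al] := leP (2 * a) lambda.
    have : C * eps * lambda < a * lambda by rewrite ltr_pM2r.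
    have : 0 <= a * (lambda - 2 * a) by rewrite mulr_ge0// subr_ge0.
    lra.
  have : C * eps * lambda < (lambda - a) * lambda by rewrite ltr_pM2r.
  have : 0 <= (lambda - a) * (2 * a - lambda).
    by rewrite mulr_ge0 ?subr_ge0// -subr_ge0 (le_trans _ (ltW la))// mulr_ge0// ltW.
  lra.
apply: (notin (Num.min 1 (d / (1 + `|lambda - 2 * a|)))).
  by rewrite lt_min ltr01 divr_gt0// ltr_wpDr.
move=> x; apply: le_of_quadratic; rewrite ?rnorm_ge0//.
rewrite -/(D x).
have D2 : rnorm (D x) ^+ 2 = a ^+ 2 * rnorm x ^+ 2 -
    2 * a * rinner (laplacian S pi x) x + rnorm (laplacian S pi x) ^+ 2.
  rewrite -!rinner_diag /D !(rinnerBl, rinnerBr, rinnerZl, rinnerZr).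
  by rewrite (rinnerC x); ring.
have cs : (lambda - 2 * a) * rinner (D x) x <=
    `|lambda - 2 * a| * rnorm (D x) * rnorm x.
  apply: le_trans (ler_norm _) _; rewrite normrM -mulrA ler_wpM2l//.
  rewrite ler_norml lerNl -rinnerNl.
  by apply/andP; split; apply: le_trans (rinner_le _ _) _; rewrite ?rnormN.
have := Alam x; rewrite DE in cs; rewrite D2 /d; lra.
Qed.
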